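(* For every fixed integer $k\ge 2$ there is a constant $C=C(k)>0$ such that the following holds. For each integer $n\ge 2$, let $\sigma_1,\dots,\sigma_k$ be permutations of $[n]=\{1,\dots,n\}$ chosen independently and uniformly at random from $S_n$. Then, as $n\to\infty$ (with $k$ fixed), \[ \mathbb{P}\left( \sigma_1,\dots,\sigma_k \text{ are } \ell\text{-similar for some integer } \ell \le C\, n^{\frac{k-1}{2k-1}} \log^{\frac{3(k-1)}{2}+\frac{1}{2k-1}}(n) \right) \ge 1 - o(n^{-1}). \]
   Context: A permutation $\sigma\in S_n$ is written as the sequence $\sigma(1),\sigma(2),\dots,\sigma(n)$. The pattern of a sequence $a_1,\dots,a_m$ of distinct real numbers is the permutation in $S_m$ obtained by replacing the $i$th smallest element of the sequence by $i$, for each $i$. Two sequences of distinct real numbers of the same length are order-isomorphic, written $\mathbf{a}\sim\mathbf{b}$, if they have the same pattern. A collection of $k$ permutations $\sigma_1,\dots,\sigma_k\in S_n$ is $\ell$-similar if, for each $j\in[k]$, the sequence $\sigma_j(1),\dots,\sigma_j(n)$ can be partitioned into $\ell$ (not necessarily contiguous) subsequences $\sigma_j^{(1)},\dots,\sigma_j^{(\ell)}$ such that $\sigma_j^{(i)}\sim\sigma_{j'}^{(i)}$ for all $i\in[\ell]$ and $j,j'\in[k]$. Here $\log^{a}(n)$ denotes $(\log n)^a$, and $o(n^{-1})$ denotes a quantity $\varepsilon(n)$ (which may depend on $k$) with $n\,\varepsilon(n)\to 0$ as $n\to\infty$. *)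

(* Defs.v *)
From HB Require Import structures.
From mathcomp Require Import all_boot all_order all_algebra all_fingroup.
From mathcomp Require Import all_classical all_reals all_analysis.
Set Implicit Arguments. Unset Strict Implicit. Unset Printing Implicit Defensive.
Import Order.TTheory GRing.Theory Num.Theory.
Import numFieldNormedType.Exports.
Local Open Scope ring_scope.

(* The pattern is given in one-line notation, as a sequence over {1, ..., m}
   with m = size a. *)
Definition pattern (d : Order.disp_t) (T : orderType d) (a : seq T) : seq nat :=
  [seq (index x (sort <=%O a)).+1 | x <- a].

(* Equality of patterns forces equality of lengths. *)
Definition order_isomorphic (d : Order.disp_t) (T : orderType d)
    (a b : seq T) : Prop :=
  pattern a = pattern b.

(* A partition of sigma(1), ..., sigma(n) into l subsequences is given by a
   labelling c of the positions by 'I_l; this is the subsequence labelled i.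
   Positions and values are numbered from 0, and subsequences may be empty. *)
Definition subsequence (n l : nat) (sigma : 'S_n) (c : 'I_n -> 'I_l)
    (i : 'I_l) : seq 'I_n :=
  [seq sigma x | x <- enum 'I_n & c x == i].

Definition perms_similar (n k l : nat) (sigma : 'I_k -> 'S_n) : Prop :=
  exists c : 'I_k -> 'I_n -> 'I_l,
    forall (i : 'I_l) (j j' : 'I_k),
      order_isomorphic (subsequence (sigma j) (c j) i)
                       (subsequence (sigma j') (c j') i).

Definition uniform_mass (R : realType) (T : finType) (x : T) : R :=
  #|T|%:R^-1.

(* Probability of the event E for s_1, ..., s_k independent and uniform on T:
   the joint mass function is the product of the marginal ones. *)
Definition prob_iid_uniform (R : realType) (T : finType) (k : nat)
    (E : ('I_k -> T) -> Prop) : R :=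
  \sum_(s : {ffun 'I_k -> T} | `[< E s >]) \prod_(j < k) uniform_mass R (s j).

(* Main.v *)
(* Cut every permutation into corresponding cells by a k-d tree: split the point set at its
   median along the longer side, recursively, down to cells of about B = log^4 n points.  The
   discrepancy of random permutations moves each cut by only about sqrt (n log n), so the
   corresponding cells of all the permutations lie within D = O(sqrt (n B)) of each other.

   Match the points of corresponding cells uniformly at random.  Matched k-tuples whose
   displacement vectors agree up to a box of side e have the same relative order unless they
   are within e of each other in one of the two coordinates.  A first moment computation, in
   which the random matching gains a factor 1/B per point, shows that for
   e^(2k-1) = (n B)^(k-1) log n a window of width e contains only O(log n) tuples of a given
   displacement class.  Greedy colouring of each of the (D/e)^(2(k-1)) classes therefore uses
   O((D/e)^(2(k-1)) log n) = O(e) colours in total, and each colour class is a tuple of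
   order-isomorphic subsequences. *)
Require Import Defs.
From HB Require Import structures.
From mathcomp Require Import all_boot all_order all_algebra all_fingroup.
From mathcomp Require Import all_classical all_reals all_analysis.
From mathcomp Require Import zify ring lra.
Set Implicit Arguments. Unset Strict Implicit. Unset Printing Implicit Defensive.
Import Order.TTheory GRing.Theory Num.Theory.
Import numFieldNormedType.Exports.
Local Open Scope ring_scope.

(** * Colourings and order-isomorphic subsequences *)

(** The cells depend on all the permutations, so permutations and matchings cannot be averaged
    together. [crowding] separates the two averages: it counts every possible partner assignment and
    ignores the cells, hence it is a function of the permutations alone and Markov's inequality
    applies to it. With the permutations then fixed, an average over the matchings inside the cells
    yields one good matching.

    The drift per cut is the same at every level: an error of sqrt (m L) points in a cell of m
    points, at density 1/n and across a side of about sqrt (n m), moves the cut by about sqrt (n L).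
    After L = O(log n) levels the drift L sqrt (n L) must still be below the leaf side sqrt (n B),
    which forces B to be at least of order L^3; the fourth power absorbs the constants.

    In the code the permutations are mostly indexed by ['I_k.+1], with [ord0] as the reference, so
    the exponents k-1 and 2k-1 appear as [k] and [2 * k + 1]. *)

Lemma greedy_coloring (T : finType) (e : rel T) (d : nat) :
  symmetric e -> (forall x, #|[set y | e x y]| < d)%N ->
  exists c : T -> 'I_d, forall x y, x != y -> e x y -> c x != c y.
Proof.
move=> esym deg.
case: (posnP #|T|) => [/card0_eq T0|/card_gt0P[x0 _]].
  have T0F (x : T) : False by have := T0 x.
  by exists (fun x => False_rect _ (T0F x)) => x; case: (T0F x).
have d0 : (0 < d)%N by apply: leq_ltn_trans (deg x0).
suff [c cP] : exists c : T -> 'I_d,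
    {in enum T &, forall x y, x != y -> e x y -> c x != c y}.
  by exists c => x y; apply: cP; rewrite mem_enum.
elim: (enum T) => [|x s [c cP]]; first by exists (fun=> Ordinal d0).
have /existsP[i /imsetP ni] : [exists i, i \notin c @: [set y | e x y]].
  rewrite -negb_forall; apply/forallP => all_i.
  have := leq_ltn_trans (leq_imset_card c [set y | e x y]) (deg x).
  suff -> : c @: [set y | e x y] = [set: 'I_d] by rewrite cardsT card_ord ltnn.
  by apply/setP => i; rewrite inE all_i.
exists (fun y => if y == x then i else c y) => y z.
rewrite !inE; case: (eqVneq y x) => [-> _|yx /= ys]; case: (eqVneq z x) => [->|zx] //=.
- move=> _ _ exz; apply/eqP => iE; case: ni; exists z => //.
  by rewrite inE.
- move=> _ _ eyx; apply/eqP => iE; case: ni; exists y; last by rewrite iE.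
  by rewrite inE esym.
- by move=> zs; apply: cP.
Qed.

(** Both sequences are images of one list [s], so sorting either amounts to sorting [s] by a
    pulled-back order. The two pulled-back orders agree on [s], and an antisymmetric total order has
    a single sorted arrangement, so the ranks coincide. *)
Lemma pattern_map (d1 d2 d3 : Order.disp_t) (S : orderType d1) (T1 : orderType d2)
    (T2 : orderType d3) (u : S -> T1) (w : S -> T2) (s : seq S) :
  injective u -> injective w ->
  {in s &, forall x y, (u x <= u y)%O = (w x <= w y)%O} ->
  pattern [seq u x | x <- s] = pattern [seq w x | x <- s].
Proof.
move=> uI wI uw; rewrite /pattern -!map_comp; apply/eq_in_map => x xs /=.
congr _.+1; rewrite !sort_map !index_map //.
congr (index x _).
set e1 := relpre u _; set e2 := relpre w _.
have e2T : total e2 by move=> y z; exact: le_total.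
have e2tr : transitive e2 by move=> y z t; exact: le_trans.
have e2a : antisymmetric e2 by move=> y z /le_anti /wI.
have -> : sort e2 s = sort e2 (sort e1 s).
  by apply/(perm_sortP e2T e2tr e2a); rewrite perm_sym perm_sort.
rewrite [RHS]sorted_sort //.
rewrite -(@eq_in_sorted _ (mem s) e1 e2) => [|y z ys zs|].
- by apply: sort_sorted => y z; exact: le_total.
- exact: uw.
- by apply/allP => y; rewrite mem_sort.
Qed.

(** [f j] sends a position of the reference permutation to its partner in [sigma j]. Being
    increasing on a colour class, it enumerates the partner class in order of position; since it
    also respects the order of values, that class has the pattern found in [sigma ord0]. *)
Lemma similar_of_coloring (n k l : nat) (sigma f : 'I_k.+1 -> 'S_n) (c : 'I_n -> 'I_l) :
  (forall j x y, c x = c y -> (x < y)%N -> (f j x < f j y)%N) ->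
  (forall j x y, c x = c y -> (sigma ord0 x < sigma ord0 y)%N ->
     (sigma j (f j x) < sigma j (f j y))%N) ->
  perms_similar l sigma.
Proof.
move=> fP sP; exists (fun j z => c ((f j)^-1%g z)) => i.
suff H j : pattern (subsequence (sigma j) (fun z => c ((f j)^-1%g z)) i) =
    pattern [seq sigma ord0 x | x <- enum 'I_n & c x == i].
  by move=> j j'; rewrite /order_isomorphic !H.
have -> : subsequence (sigma j) (fun z => c ((f j)^-1%g z)) i =
    [seq sigma j (f j x) | x <- enum 'I_n & c x == i].
  rewrite /subsequence (map_comp (sigma j) (f j)); congr (map _ _).
  have srt : sorted (fun x y : 'I_n => (x < y)%N) (enum 'I_n).
    by have := iota_ltn_sorted 0 n; rewrite -val_enum_ord sorted_map.
  have tr : transitive (fun x y : 'I_n => (x < y)%N) by move=> a b e; apply: ltn_trans.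
  apply: (@irr_sorted_eq _ (fun x y : 'I_n => (x < y)%N)).
  - by [].
  - by move=> a; rewrite ltnn.
  - exact: sorted_filter.
  - rewrite sorted_map; apply: (@sub_in_sorted _ (mem [pred x | c x == i])).
    + by move=> x y /eqP cx /eqP cy /= xy; apply: (fP j x y _ xy); exact: etrans cx (esym cy).
    + by apply/allP => x; rewrite mem_filter => /andP[].
    + exact: (sorted_filter tr _ srt).
  - move=> z; rewrite mem_filter mem_enum andbT; apply/idP/mapP.
      move=> cz; exists ((f j)^-1%g z); last by rewrite permKV.
      by rewrite mem_filter cz mem_enum.
    by case=> x; rewrite mem_filter => /andP[cx _] ->; rewrite permK.
apply: (@pattern_map _ _ _ 'I_n 'I_n 'I_n (fun x => sigma j (f j x)) (sigma ord0)).
- exact: inj_comp perm_inj perm_inj.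
- exact: perm_inj.
move=> x y; rewrite !mem_filter => /andP[/eqP cx _] /andP[/eqP cy _].
have h a b : c a = c b -> (sigma ord0 a < sigma ord0 b)%N ->
  (sigma j (f j a) <= sigma j (f j b))%O = (sigma ord0 a <= sigma ord0 b)%O.
  move=> cab ab; rewrite !leEord (ltnW ab); apply/ltnW/sP => //.
have h' a b : c a = c b -> (sigma ord0 a < sigma ord0 b)%N ->
  (sigma j (f j b) <= sigma j (f j a))%O = (sigma ord0 b <= sigma ord0 a)%O.
  by move=> cab ab; rewrite !leEord leqNgt (sP _ _ _ cab ab) [RHS]leqNgt ab.
case: (ltngtP (sigma ord0 x) (sigma ord0 y)) => xy.
- by apply: h => //; rewrite cx.
- by apply: h' => //; rewrite cx.
- by move/val_inj/perm_inj: xy => ->; rewrite !lexx.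
Qed.

(** * Switching in groups of label-preserving permutations *)

Definition label_preserving (n : nat) (lab : 'I_n -> nat) : {set 'S_n} :=
  [set t : 'S_n | [forall x, lab (t x) == lab x]].

(* Switching: composing with a transposition that moves [h a] to another element of its class
   frees the value at [h a]; the map is injective. *)
Lemma card_label_preserving_step (n B : nat) (lab : 'I_n -> nat) (P : pred 'S_n)
    (X : {set 'I_n}) (a b : 'I_n) :
  a \notin X ->
  (B <= #|[set y | lab y == lab a]|)%N ->
  (forall (t : 'S_n) y, y \notin X -> P t -> P (tperm a y * t)%g) ->
  (#|[set t in label_preserving lab | P t && (t a == b)]| * (B - #|X|) <=
   #|[set t in label_preserving lab | P t]|)%N.
Proof.
move=> aX labB PX.
pose C := [set y | lab y == lab a] :\: X.
have CB : (B - #|X| <= #|C|)%N.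
  by rewrite cardsD; apply: leq_sub labB _; apply/subset_leq_card/subsetIr.
apply: leq_trans (leq_mul (leqnn _) CB) _.
rewrite -cardsX.
rewrite -(@card_in_imset _ _ (fun p : 'S_n * 'I_n => tperm a p.2 * p.1)%g).
  apply/subset_leq_card/fintype.subsetP => t' /imsetP[[t y]].
  rewrite !inE /= => /andP[/andP[/forallP tG /andP[Pt _]] /andP[yX /eqP ya]] ->.
  rewrite PX // andbT; apply/forallP => z; rewrite permM (eqP (tG _)).
  by case: tpermP => [->|->|//]; rewrite ya.
move=> [t y] [t' y']; rewrite !inE /= => /andP[/andP[_ /andP[_ /eqP ta]] _].
move=> /andP[/andP[_ /andP[_ /eqP ta']] _] E.
have yy : y = y'.
  have := congr1 (fun s : 'S_n => s y) E; rewrite permM tpermR ta permM => Eb.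
  move: ta'; rewrite Eb => /perm_inj aE.
  by have := tpermK a y' y; rewrite -aE tpermL => ->.
by move: E; rewrite -yy => /mulgI ->.
Qed.

(** Each prescribed value is one switching, with at least [B - m] free targets when [m] values are
    already prescribed. As [2 * #|X| <= B], this is at least half of [B], whence a factor 2 per
    point: the event has probability at most (2/B)^|X|. *)
Lemma card_label_preserving_on (n B : nat) (lab : 'I_n -> nat) (X : {set 'I_n})
    (h g : 'I_n -> 'I_n) :
  (forall x, (B <= #|[set y | lab y == lab x]|)%N) ->
  {in X &, injective h} -> (2 * #|X| <= B)%N ->
  (#|[set t in label_preserving lab | [forall x in X, t (h x) == g x]]| * B ^ #|X| <=
   2 ^ #|X| * #|label_preserving lab|)%N.
Proof.
move=> labB.
elim: {X}#|X| {-2}X (erefl #|X|) => [|m IH] X Xm hI XB.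
  rewrite Xm !expn0 muln1 mul1n; apply: subset_leq_card.
  by apply/fintype.subsetP => t; rewrite inE => /andP[].
have [a aX] : exists a, a \in X by apply/card_gt0P; rewrite Xm.
have Xa : #|X :\ a| = m by move: Xm; rewrite (cardsD1 a) aX => -[].
have hIa : {in X :\ a &, injective h}.
  by move=> x y; rewrite !inE => /andP[_ xX] /andP[_ yX]; apply: hI.
have := IH _ Xa hIa; rewrite Xa Xm => /(_ ltac:(lia)) IHa.
pose P := fun t : 'S_n => [forall x in X :\ a, t (h x) == g x].
have hc : #|[set h x | x in X :\ a]| = m by rewrite card_in_imset.
have hni : h a \notin [set h x | x in X :\ a].
  apply/imsetP => -[x]; rewrite !inE => /andP[xa xX] /hI; rewrite aX xX => /(_ isT isT) E.
  by rewrite E eqxx in xa.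
have := @card_label_preserving_step n B lab P [set h x | x in X :\ a] (h a) (g a) hni (labB _).
rewrite hc => step.
have {}step : (#|[set t in label_preserving lab | [forall x in X, t (h x) == g x]]| * (B - m)
   <= #|[set t in label_preserving lab | P t]|)%N.
  apply: leq_trans (step _).
    rewrite leq_mul2r; apply/orP; right.
    apply/subset_leq_card/fintype.subsetP => t; rewrite !inE => /andP[-> /forallP H] /=.
    apply/andP; split; last by apply: (implyP (H a)).
    by apply/forallP => x; apply/implyP; rewrite !inE => /andP[_]; apply/implyP/H.
  move=> t y yN /forallP Pt; apply/forallP => x; apply/implyP => xX.
  have hxX : h x \in [set h x | x in X :\ a] by apply: imset_f.
  rewrite permM tpermD; first by have /implyP := Pt x; apply.
    by apply: contraNneq hni => ->.
  by apply: contraNneq yN => ->.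
rewrite !expnS.
set N := #|_| in step *; set N' := #|_| in step IHa.
have B2 : (B <= 2 * (B - m))%N by lia.
rewrite mulnA; apply: leq_trans (_ : N * (2 * (B - m)) * B ^ m <= _)%N.
  by rewrite leq_mul2r leq_mul2l B2 !orbT.
have -> : (N * (2 * (B - m)) * B ^ m = 2 * (N * (B - m) * B ^ m))%N by ring.
rewrite -[X in (_ <= X)%N]mulnA leq_mul2l /=; apply: leq_trans IHa.
by rewrite leq_mul2r step orbT.
Qed.

Lemma card_union_bound (T I : finType) (P : pred I) (A : {set T}) (F : I -> {set T}) :
  (forall t, t \in A -> exists2 i, P i & t \in F i) ->
  (#|A| <= \sum_(i | P i) #|F i|)%N.
Proof.
move=> AF; apply: (@leq_trans (\sum_(t : T) \sum_(i | P i) (t \in F i))); last first.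
  rewrite exchange_big /=; apply: leq_sum => i _.
  by rewrite -sum1_card [X in (_ <= X)%N]big_mkcond /=; apply: leq_sum => t _; case: (t \in F i).
rewrite -sum1_card big_mkcond /=; apply: leq_sum => t _.
case: ifPn => // /AF[i Pi tF]; rewrite (bigD1 i) //= tF; exact: leq_addr.
Qed.

Lemma card_ord_interval (n a e d : nat) :
  (#|[set z : 'I_n | a <= z + d < a + e]| <= e)%N.
Proof.
rewrite cardE -(size_map (fun z : 'I_n => (z + d)%N)) -[leqRHS](size_iota a).
apply: uniq_leq_size.
  by rewrite map_inj_uniq ?enum_uniq // => x y /addIn/val_inj.
by move=> y /mapP[z]; rewrite mem_enum inE => zP ->; rewrite mem_iota.
Qed.

(** Imposing the identity off [X] makes every partial assignment on [X] count exactly once. *)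
Definition choices_on (n : nat) (X : {set 'I_n}) (A : 'I_n -> {set 'I_n}) :
    {set {ffun 'I_n -> 'I_n}} :=
  [set h : {ffun 'I_n -> 'I_n} | [forall x, if x \in X then h x \in A x else h x == x]].

Lemma card_choices_on (n e : nat) (X : {set 'I_n}) (A : 'I_n -> {set 'I_n}) :
  (forall x, #|A x| <= e)%N -> (#|choices_on X A| <= e ^ #|X|)%N.
Proof.
move=> Ae; pose F x := mem (if x \in X then A x else [set x]).
have -> : #|choices_on X A| = #|family F|.
  apply: eq_card => h; rewrite inE; apply/forallP/familyP => H x; have := H x;
    by rewrite /F; case: ifP => // _; rewrite ?inE.
rewrite card_family foldrE big_image /= (bigID (mem X)) /= -prod_nat_const -[leqRHS]muln1.
apply: leq_mul.
  by apply: leq_prod => x xX; rewrite /F xX.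
by rewrite big1 // => x /negPf xX; rewrite /F xX cards1.
Qed.

Definition shifted_interval (n D e v x : nat) : {set 'I_n} :=
  [set z : 'I_n | (x + v * e <= z + D < x + v * e + e)%N].

(* Injective assignments [h] of partners in [s] to the points [x \in X] of [s0] such that each
   displacement, offset by [D] and measured in units of [e], lies in the box [v]. *)
Definition partners (n D e : nat) (X : {set 'I_n}) (s0 s : 'S_n) (v : nat * nat) :=
  [set h in choices_on X (fun x => shifted_interval n D e v.1 x) |
    [forall x in X, s (h x) \in shifted_interval n D e v.2 (s0 x)] &&
    [forall x in X, forall y in X, (h x == h y) ==> (x == y)]].

(** With a single class, the switching bound also covers uniform permutations, with [n] in the role
    of [B]. *)
Lemma label_preserving_const (n : nat) : label_preserving (fun=> 0%N) = [set: 'S_n].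
Proof. by apply/setP => t; rewrite !inE; apply/forallP. Qed.

(** There are at most e^|X| choices for the positions [h] and e^|X| for the values [g] taken there,
    and switching shows that a given pair occurs in a fraction at most (2/n)^|X| of the
    permutations. *)
Lemma sum_card_partners (n D e : nat) (X : {set 'I_n}) (s0 : 'S_n) (v : nat * nat) :
  (2 * #|X| <= n)%N ->
  ((\sum_(s : 'S_n) #|partners D e X s0 s v|) * n ^ #|X| <= (2 * e ^ 2) ^ #|X| * n`!)%N.
Proof.
move=> Xn.
pose H1 := choices_on X (fun x => shifted_interval n D e v.1 x).
pose H2 := choices_on X (fun x => shifted_interval n D e v.2 (s0 x)).
pose J := [set h : {ffun 'I_n -> 'I_n} |
  [forall x in X, forall y in X, (h x == h y) ==> (x == y)]].
pose F (h g : {ffun 'I_n -> 'I_n}) :=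
  [set s : 'S_n in label_preserving (fun=> 0%N) | [forall x in X, s (h x) == g x]].
have FP h g : h \in J -> (#|F h g| * n ^ #|X| <= 2 ^ #|X| * n`!)%N.
  move=> hJ; have <- : #|label_preserving (fun _ : 'I_n => 0%N)| = n`!.
    by rewrite label_preserving_const cardsT card_Sn.
  apply: card_label_preserving_on => //.
    by move=> x; rewrite (_ : finset _ = [set: 'I_n]) ?cardsT ?card_ord.
  move=> x y xX yX hxy; move: hJ; rewrite inE => /forallP/(_ x)/implyP/(_ xX).
  by move=> /forallP/(_ y)/implyP/(_ yX); rewrite hxy eqxx => /eqP.
have -> : (\sum_(s : 'S_n) #|partners D e X s0 s v| =
    \sum_(h in H1 :&: J) #|[set s : 'S_n | [forall x in X, s (h x) \in
      shifted_interval n D e v.2 (s0 x)]]|)%N.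
  transitivity (\sum_(s : 'S_n) \sum_(h in H1 :&: J) ([forall x in X, s (h x) \in
      shifted_interval n D e v.2 (s0 x)]))%N.
    apply: eq_bigr => s _; rewrite -sum1_card big_mkcond [RHS]big_mkcond /=.
    have if_andCA (a b c : bool) : (if a && (b && c) then 1 else 0)%N =
        (if a && c then nat_of_bool b else 0%N) by case: a b c => [] [] [].
    by apply: eq_bigr => h _; rewrite !inE; apply: if_andCA.
  rewrite exchange_big /=; apply: eq_bigr => h _.
  by rewrite -sum1_card [RHS]big_mkcond /=; apply: eq_bigr => s _; rewrite inE; case: ifP.
rewrite big_distrl /=.
apply: (@leq_trans (\sum_(h in H1 :&: J) \sum_(g in H2) 2 ^ #|X| * n`!)%N).
  apply: leq_sum => h /setIP[_ hJ].
  apply: (@leq_trans ((\sum_(g in H2) #|F h g|) * n ^ #|X|)%N).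
    rewrite leq_mul2r; apply/orP; right.
    apply: card_union_bound => s; rewrite inE => /forallP sP.
    exists [ffun x => if x \in X then s (h x) else x].
      rewrite inE; apply/forallP => x; rewrite ffunE; case: (boolP (x \in X)) => // xX.
      exact: (implyP (sP x) xX).
    rewrite inE label_preserving_const inE /=; apply/forallP => x; apply/implyP => xX.
    by rewrite ffunE xX.
  by rewrite big_distrl /=; apply: leq_sum => g _; apply: FP.
rewrite !sum_nat_const.
have c1 : (#|H1 :&: J| <= e ^ #|X|)%N.
  apply: leq_trans (subset_leq_card (subsetIl _ _)) (card_choices_on _ _) => x.
  exact: card_ord_interval.
have c2 : (#|H2| <= e ^ #|X|)%N.
  by apply: card_choices_on => x; exact: card_ord_interval.
have -> : ((2 * e ^ 2) ^ #|X| * n`! = e ^ #|X| * (e ^ #|X| * (2 ^ #|X| * n`!)))%N.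
  by rewrite expnMn -mulnn expnMn; ring.
by apply: leq_mul => //; apply: leq_mul.
Qed.

(** * Random matchings and their crowded windows *)

(** Here the permutations are fixed and only [t] varies. A displaced [t] determines on [X] an
    element [h] of [partners], through [f (t x) = h x], and each such [h] is realised with
    probability at most (2/B)^|X|. *)
Lemma card_label_preserving_displaced (n D e B : nat) (lab : 'I_n -> nat) (X : {set 'I_n})
    (s0 s f : 'S_n) (v : nat * nat) :
  (forall x, (B <= #|[set y | lab y == lab x]|)%N) -> (2 * #|X| <= B)%N ->
  (#|[set t in label_preserving lab | [forall x in X,
       (f (t x) \in shifted_interval n D e v.1 x) &&
       (s (f (t x)) \in shifted_interval n D e v.2 (s0 x))]]| * B ^ #|X| <=
   #|partners D e X s0 s v| * 2 ^ #|X| * #|label_preserving lab|)%N.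
Proof.
move=> labB XB.
pose F (h : {ffun 'I_n -> 'I_n}) :=
  [set t in label_preserving lab | [forall x in X, t x == (f^-1)%g (h x)]].
apply: (@leq_trans ((\sum_(h in partners D e X s0 s v) #|F h|) * B ^ #|X|)).
  rewrite leq_mul2r; apply/orP; right.
  apply: card_union_bound => t; rewrite inE => /andP[tG /forallP tP].
  exists [ffun x => if x \in X then f (t x) else x].
    rewrite !inE; apply/and3P; split.
    - apply/forallP => x; rewrite ffunE; case: (boolP (x \in X)) => // xX.
      by case/andP: (implyP (tP x) xX).
    - apply/forallP => x; apply/implyP => xX; rewrite ffunE xX.
      by case/andP: (implyP (tP x) xX).
    - apply/forallP => x; apply/implyP => xX; apply/forallP => y; apply/implyP => yX.
      by rewrite !ffunE xX yX; apply/implyP => /eqP/perm_inj/perm_inj ->.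
  rewrite inE tG /=; apply/forallP => x; apply/implyP => xX.
  by rewrite ffunE xX permK.
rewrite big_distrl /= -mulnA -sum_nat_const.
apply: leq_sum => h _.
exact: (@card_label_preserving_on n B lab X id (fun x => (f^-1)%g (h x))).
Qed.

Definition window (n e : nat) (s0 : 'S_n) (p : bool * 'I_n) : {set 'I_n} :=
  [set x | let z := if p.1 then x else s0 x in (z < p.2 + e)%N && (p.2 < z + e)%N].

Lemma card_window (n e : nat) (s0 : 'S_n) (p : bool * 'I_n) : (#|window e s0 p| <= 2 * e)%N.
Proof.
case: p => b a.
have H : (#|[set z : 'I_n | (a <= z + e < a + 2 * e)%N]| <= 2 * e)%N.
  exact: card_ord_interval.
apply: leq_trans H; case: b.
  by apply/subset_leq_card/fintype.subsetP => x; rewrite !inE /=; lia.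
rewrite -(card_imset _ (@perm_inj _ s0)).
apply/subset_leq_card/fintype.subsetP => y /imsetP[x]; rewrite !inE /= => xP ->.
by move: xP; lia.
Qed.

(* Up to the factor [(2 / B) ^ (r * k)] this bounds the expected number, over random matchings
   inside cells of size at least [B], of windows containing [r] points of one displacement class. *)
Definition crowding (n k D e M r : nat) (s : {ffun 'I_k.+1 -> 'S_n}) : nat :=
  \sum_(v : {ffun 'I_k -> 'I_M * 'I_M}) \sum_(p : bool * 'I_n)
   \sum_(X : {set 'I_n} | (X \subset window e (s ord0) p) && (#|X| == r))
    \prod_(j < k) #|partners D e X (s ord0) (s (lift ord0 j)) ((v j).1 : nat, (v j).2 : nat)|.

(** The [k] matchings are chosen independently, so their (2/B)^r factors multiply. The hypothesis on
    [crowding] says that the expected number of crowded triples (class, window, r-subset) is below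
    1, so some choice has none. *)
Lemma exists_uncrowded_matching (n k D e M r B : nat) (lab : 'I_n -> nat) (s : {ffun 'I_k.+1 -> 'S_n})
    (f : 'I_k -> 'S_n) :
  (forall x, (B <= #|[set y | lab y == lab x]|)%N) -> (2 * r <= B)%N ->
  (crowding D e M r s * 2 ^ (r * k) < B ^ (r * k))%N ->
  exists2 t : 'I_k -> 'S_n, (forall j, t j \in label_preserving lab) &
    forall (v : 'I_k -> 'I_M * 'I_M) (p : bool * 'I_n) (X : {set 'I_n}),
      X \subset window e (s ord0) p -> #|X| = r ->
      ~ (forall j x, x \in X ->
          (f j (t j x) \in shifted_interval n D e (v j).1 x) &&
          (s (lift ord0 j) (f j (t j x)) \in shifted_interval n D e (v j).2 (s ord0 x))).
Proof.
move=> labB rB small.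
pose bad j (X : {set 'I_n}) (v : nat * nat) := [set t in label_preserving lab | [forall x in X,
   (f j (t x) \in shifted_interval n D e v.1 x) &&
   (s (lift ord0 j) (f j (t x)) \in shifted_interval n D e v.2 (s ord0 x))]].
pose I := ({ffun 'I_k -> 'I_M * 'I_M} * (bool * 'I_n) * {set 'I_n})%type.
pose P (i : I) := (i.2 \subset window e (s ord0) i.1.2) && (#|i.2| == r).
pose Bad (i : I) : {set {ffun 'I_k -> 'S_n}} :=
  [set t : {ffun 'I_k -> 'S_n} | [forall j, t j \in bad j i.2 ((i.1.1 j).1 : nat, (i.1.1 j).2 : nat)]].
pose G := [set t : {ffun 'I_k -> 'S_n} | [forall j, t j \in label_preserving lab]].
have cG : #|G| = (#|label_preserving lab| ^ k)%N.
  rewrite -[k in RHS]card_ord -card_ffun_on; apply: eq_card => t; rewrite inE.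
  by apply/forallP/ffun_onP.
have cBad i : #|Bad i| = (\prod_(j < k) #|bad j i.2 ((i.1.1 j).1 : nat, (i.1.1 j).2 : nat)|)%N.
  pose F j := mem (bad j i.2 ((i.1.1 j).1 : nat, (i.1.1 j).2 : nat)).
  have -> : #|Bad i| = #|family F|.
    by apply: eq_card => t; rewrite inE; apply/forallP/familyP.
  by rewrite card_family foldrE big_image.
have [/existsP[t /andP[tG /existsPn tB]]|/existsPn H] :=
    boolP [exists t, (t \in G) && ~~ [exists i : I, P i && (t \in Bad i)]].
  exists t; first by move: tG; rewrite inE => /forallP.
  move=> v p X XW Xr H.
  have := tB (([ffun j => v j], p), X); rewrite /P /= XW Xr eqxx /= => /negP; apply.
  rewrite inE; apply/forallP => j; rewrite /= ffunE inE.
  move: tG; rewrite inE => /forallP/(_ j) -> /=; apply/forallP => x; apply/implyP => xX.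
  exact: H.
have Gle : (#|G| <= \sum_(i | P i) #|Bad i|)%N.
  apply: card_union_bound => t tG; have := H t; rewrite tG /= negbK.
  by case/existsP => i /andP[Pi ti]; exists i.
have cr : (\sum_(i | P i) \prod_(j < k) #|partners D e i.2 (s ord0) (s (lift ord0 j))
    ((i.1.1 j).1 : nat, (i.1.1 j).2 : nat)| = crowding D e M r s)%N.
  rewrite /crowding pair_big /=  pair_big_dep /=.
  by apply: eq_big => [[[v p] X]|[[v p] X]].
have g0 : (0 < #|label_preserving lab|)%N.
  apply/card_gt0P; exists 1%g; rewrite inE; apply/forallP => x; by rewrite perm1.
suff : (#|G| * B ^ (r * k) <= crowding D e M r s * 2 ^ (r * k) * #|G|)%N.
  by rewrite mulnC leq_mul2r cG expn_eq0 eqn0Ngt g0 /= leqNgt small.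
apply: (@leq_trans ((\sum_(i | P i) #|Bad i|) * B ^ (r * k))); first by rewrite leq_mul2r Gle orbT.
rewrite -cr !big_distrl /=; apply: leq_sum => i /andP[_ /eqP ir].
rewrite cBad cG !expnM.
have powE a : (a ^ k = \prod_(j < k) a)%N by rewrite prod_nat_const card_ord.
rewrite !powE -!big_split /=.
apply: leq_prod => j _; rewrite -ir.
by apply: card_label_preserving_displaced; rewrite ?ir.
Qed.

(** Independence of the other coordinates once the one at [ord0] is fixed; in the proof [F] uses the
    indicator of [a] as the factor of coordinate [ord0]. *)
Lemma sum_ffun_prod_ord0 (k : nat) (T : finType) (a : T) (A : 'I_k -> T -> nat) :
  (\sum_(s : {ffun 'I_k.+1 -> T} | s ord0 == a) \prod_(j < k) A j (s (lift ord0 j)) =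
   \prod_(j < k) \sum_(t : T) A j t)%N.
Proof.
pose F (i : 'I_k.+1) (t : T) : nat := if unlift ord0 i is Some j then A j t else (t == a).
transitivity (\prod_(i < k.+1) \sum_(t : T) F i t)%N; last first.
  have -> : (\prod_(i < k.+1) \sum_(t : T) F i t = (\sum_(t : T) F ord0 t) *
      \prod_(j < k) \sum_(t : T) F (lift ord0 j) t)%N by exact: big_ord_recl.
  have -> : (\sum_(t : T) F ord0 t = 1)%N.
    rewrite /F unlift_none (bigD1 a) //= eqxx big1 // => t /negPf -> //.
  by rewrite mul1n; apply: eq_bigr => j _; apply: eq_bigr => t _; rewrite /F liftK.
rewrite bigA_distr_bigA /= [LHS]big_mkcond /=; apply: eq_bigr => s _.
rewrite big_ord_recl /F unlift_none; case: eqP => _; last by rewrite mul0n.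
by rewrite mul1n; apply: eq_bigr => j _; rewrite liftK.
Qed.

(** Windows are defined by [s ord0] alone. Conditioning on it fixes the range of [X], and the
    remaining [k] permutations contribute independent factors (2 e^2 / n)^r. *)
Lemma sum_crowding (n k D e M r : nat) : (2 * r <= n)%N ->
  ((\sum_(s : {ffun 'I_k.+1 -> 'S_n}) crowding D e M r s) * n ^ (r * k) <=
    (M * M) ^ k * (2 * n) * 'C(2 * e, r) * (2 * e ^ 2) ^ (r * k) * n`! ^ k.+1)%N.
Proof.
move=> rn.
rewrite exchange_big /= -!mulnA.
have -> : ((M * M) ^ k = #|[set: {ffun 'I_k -> 'I_M * 'I_M}]|)%N.
  by rewrite cardsT card_ffun card_prod !card_ord.
rewrite cardsT -sum_nat_const big_distrl /=; apply: leq_sum => v _.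
rewrite exchange_big /= big_distrl /=.
apply: (@leq_trans (\sum_(p : bool * 'I_n) ('C(2 * e, r) * ((2 * e ^ 2) ^ (r * k) * n`! ^ k.+1)))%N);
  last by rewrite sum_nat_const card_prod card_bool card_ord; apply/eq_leq; ring.
apply: leq_sum => p _.
rewrite (partition_big (fun s : {ffun 'I_k.+1 -> 'S_n} => s ord0) xpredT) //= big_distrl /=.
apply: (@leq_trans (\sum_(s0 : 'S_n) ('C(2 * e, r) * ((2 * e ^ 2) ^ (r * k) * n`! ^ k)))%N);
  last by rewrite sum_nat_const card_Sn (expnS n`!); apply/eq_leq; ring.
apply: leq_sum => s0 _.
have -> : (\sum_(s : {ffun 'I_k.+1 -> 'S_n} | s ord0 == s0)
    \sum_(X : {set 'I_n} | (X \subset window e (s ord0) p) && (#|X| == r))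
      \prod_(j < k) #|partners D e X (s ord0) (s (lift ord0 j)) ((v j).1 : nat, (v j).2 : nat)| =
    \sum_(X : {set 'I_n} | (X \subset window e s0 p) && (#|X| == r))
      \prod_(j < k) \sum_(t : 'S_n) #|partners D e X s0 t ((v j).1 : nat, (v j).2 : nat)|)%N.
  under eq_bigr => s /eqP -> do [].
  rewrite exchange_big /=; apply: eq_bigr => X _.
  exact: (sum_ffun_prod_ord0 s0 (fun j t => #|partners D e X s0 t ((v j).1 : nat, (v j).2 : nat)|)).
rewrite big_distrl /=.
apply: (@leq_trans (\sum_(X : {set 'I_n} | (X \subset window e s0 p) && (#|X| == r))
    ((2 * e ^ 2) ^ (r * k) * n`! ^ k))%N).
  apply: leq_sum => X /andP[_ /eqP Xr].
  have powE a : (a ^ k = \prod_(j < k) a)%N by rewrite prod_nat_const card_ord.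
  rewrite !expnM !powE -!big_split /=; apply: leq_prod => j _.
  by rewrite -Xr; apply: sum_card_partners; rewrite Xr.
rewrite sum_nat_const leq_mul2r; apply/orP; right.
rewrite -cardsE cards_draws.
by apply: leq_bin2l; exact: card_window.
Qed.

Lemma mem_shifted_interval_div (n D e : nat) (z : 'I_n) (x : nat) :
  (0 < e)%N -> (x <= z + D)%N -> z \in shifted_interval n D e ((z + D - x) %/ e) x.
Proof.
move=> e0 xz; rewrite inE.
have := divn_eq (z + D - x) e; have := ltn_pmod (z + D - x) e0; set q := (_ %/ _)%N; lia.
Qed.

Lemma shifted_interval_lt (n D e v x x' : nat) (z z' : 'I_n) :
  z \in shifted_interval n D e v x -> z' \in shifted_interval n D e v x' ->
  (x + e <= x')%N -> (z < z')%N.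
Proof. by rewrite !inE; lia. Qed.

(** A conflict graph joins points of one class that are within [e] in position or in value. The
    neighbours of a point lie in two windows, each holding fewer than [r] points of the class, so
    [2 * r] colours suffice; the final label is the pair of class and colour. *)
Lemma similar_of_uncrowded (n k D e M r : nat) (s : {ffun 'I_k.+1 -> 'S_n})
    (g : 'I_k -> 'S_n) :
  (0 < e)%N -> (2 * D < M * e)%N ->
  (forall j x, [/\ g j x <= x + D, x <= g j x + D,
     s (lift ord0 j) (g j x) <= s ord0 x + D & s ord0 x <= s (lift ord0 j) (g j x) + D]%N) ->
  (forall (v : 'I_k -> 'I_M * 'I_M) (p : bool * 'I_n) (X : {set 'I_n}),
      X \subset window e (s ord0) p -> #|X| = r ->
      ~ (forall j x, x \in X ->
          (g j x \in shifted_interval n D e (v j).1 x) &&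
          (s (lift ord0 j) (g j x) \in shifted_interval n D e (v j).2 (s ord0 x)))) ->
  perms_similar ((M * M) ^ k * (2 * r)) s.
Proof.
move=> e0 DM close unc.
have b1 j x : ((g j x + D - x) %/ e < M)%N.
  by rewrite ltn_divLR //; case: (close j x); lia.
have b2 j x : ((s (lift ord0 j) (g j x) + D - s ord0 x) %/ e < M)%N.
  by rewrite ltn_divLR //; case: (close j x); lia.
pose cl x := [ffun j => (Ordinal (b1 j x), Ordinal (b2 j x))].
have cl1 j x : g j x \in shifted_interval n D e (cl x j).1 x.
  by rewrite ffunE; apply: mem_shifted_interval_div => //; case: (close j x).
have cl2 j x : s (lift ord0 j) (g j x) \in shifted_interval n D e (cl x j).2 (s ord0 x).
  by rewrite ffunE; apply: mem_shifted_interval_div => //; case: (close j x).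
have few x p : (#|[set y in window e (s ord0) p | cl y == cl x]| < r)%N.
  rewrite ltnNge; apply/negP => rle.
  (* A positive binomial coefficient supplies a subset of exactly [r] points, the size that the
     hypothesis excludes. *)
  have : (0 < 'C(#|[set y in window e (s ord0) p | cl y == cl x]|, r))%N by rewrite bin_gt0.
  rewrite -cards_draws => /card_gt0P[X]; rewrite inE => /andP[XS /eqP Xr].
  apply: (unc (cl x) p X) => //.
    by apply: fintype.subset_trans XS _; apply/fintype.subsetP => y; rewrite inE => /andP[].
  move=> j y yX; have /(fintype.subsetP XS) := yX.
  by rewrite inE => /andP[_ /eqP <-]; rewrite cl1 cl2.
pose E x y := (cl x == cl y) && ((y < x + e)%N && (x < y + e)%N ||
   (s ord0 y < s ord0 x + e)%N && (s ord0 x < s ord0 y + e)%N).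
have Esym : symmetric E.
  by move=> x y; rewrite /E eq_sym; congr (_ && _); lia.
have deg x : (#|[set y | E x y]| < 2 * r)%N.
  pose W b a := [set y in window e (s ord0) (b, a) | cl y == cl x].
  apply: (@leq_ltn_trans (#|W true x| + #|W false (s ord0 x)|)%N); last first.
    by have := few x (true, x); have := few x (false, s ord0 x); rewrite -/(W _ _) -/(W _ _); lia.
  apply: leq_trans (leq_card_setU _ _); apply: subset_leq_card.
  apply/fintype.subsetP => y; rewrite !inE /E /= => /andP[/eqP ->]; rewrite eqxx !andbT.
  by [].
have [c cP] := greedy_coloring Esym deg.
pose T : finType := ({ffun 'I_k -> 'I_M * 'I_M} * 'I_(2 * r))%type.
have cT : #|T| = ((M * M) ^ k * (2 * r))%N by rewrite card_prod card_ffun card_prod !card_ord.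
rewrite -cT.
pose f (i : 'I_k.+1) : 'S_n := if unlift ord0 i is Some j then g j else 1%g.
have key x y : enum_rank ((cl x, c x) : T) = enum_rank ((cl y, c y) : T) -> x != y ->
    cl x = cl y /\ ((x + e <= y)%N || (y + e <= x)%N) &&
      ((s ord0 x + e <= s ord0 y)%N || (s ord0 y + e <= s ord0 x)%N).
  move=> /enum_rank_inj[clE cE] xy; split=> //.
  have : ~~ E x y by apply/negP => /(cP _ _ xy); rewrite cE eqxx.
  rewrite /E clE eqxx /=; lia.
apply: (@similar_of_coloring _ _ _ s f (fun x => enum_rank ((cl x, c x) : T))).
  move=> i x y /key H xy; case: H => [|clE]; first by apply: contraTneq xy => ->; rewrite ltnn.
  move=> /andP[H _]; rewrite /f; case: unliftP => [j _|_]; last by rewrite !perm1.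
  have := cl1 j y; rewrite -clE => cly.
  by apply: (shifted_interval_lt (cl1 j x) cly); lia.
move=> i x y /key H xy; case: H => [|clE]; first by apply: contraTneq xy => ->; rewrite ltnn.
move=> /andP[_ H]; rewrite /f; case: unliftP => [j ->|->]; last by rewrite !perm1.
have := cl2 j y; rewrite -clE => cly.
by apply: (shifted_interval_lt (cl2 j x) cly); lia.
Qed.

(** * Partitions into corresponding cells *)

(** Corresponding cells have equal sizes, so some bijection carries the cells of one permutation to
    those of another; composing it with a random label-preserving permutation gives a random
    matching. *)
Lemma relabeling_perm (n : nat) (lab lab' : 'I_n -> nat) :
  (forall c, #|[set x | lab x == c]| = #|[set x | lab' x == c]|) ->
  exists f : 'S_n, forall x, lab' (f x) = lab x.
Proof.
move=> H.
have : perm_eq (codom_tuple lab) (codom_tuple lab').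
  have cnt (l : 'I_n -> nat) c : count_mem c (codom l) = #|[set x | l x == c]|.
    by rewrite codomE count_map -sum1_count -sum1dep_card big_enum_cond.
  by apply/allP => c _ /=; rewrite !cnt H.
move/tuple_permP => [p pE].
have fI : injective (fun x : 'I_n => enum_val (p (enum_rank x))).
  by move=> x y /enum_val_inj/perm_inj/enum_rank_inj.
exists (perm fI) => x; rewrite permE.
have tn (l : 'I_n -> nat) i : tnth (codom_tuple l) i = l (enum_val i).
  by rewrite tnth_map /tnth -enum_val_nth.
by rewrite -tn -(tnth_mktuple (fun i => tnth (codom_tuple lab') (p i))) -(val_inj pE) tn enum_rankK.
Qed.

(* Points of different permutations with the same label lie in corresponding cells. *)
Definition cellular (n k B : nat) (near : 'I_k -> 'I_n -> 'I_k -> 'I_n -> Prop)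
    (P : 'I_k -> {set 'I_n}) : Prop :=
  exists N (lab : 'I_k -> 'I_n -> nat),
   [/\ forall j x, x \in P j -> (lab j x < N)%N,
       forall i j c, #|[set x in P i | lab i x == c]| = #|[set x in P j | lab j x == c]|,
       forall j x, x \in P j -> (B <= #|[set y in P j | lab j y == lab j x]|)%N &
       forall i j x y, x \in P i -> y \in P j -> lab i x = lab j y -> near i x j y].

Lemma cellular_single (n k B m : nat) (near : 'I_k -> 'I_n -> 'I_k -> 'I_n -> Prop)
    (P : 'I_k -> {set 'I_n}) :
  (B <= m)%N -> (forall j, #|P j| = m) ->
  (forall i j x y, x \in P i -> y \in P j -> near i x j y) -> cellular B near P.
Proof.
move=> Bm Pm Pnear; exists 1%N, (fun _ _ => 0%N).
have E j c : [set x in P j | 0 == c]%N = if c == 0%N then P j else finset.set0.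
  by case: c => [|c]; apply/setP => x; rewrite !inE ?andbT ?andbF.
split=> //.
- by move=> i j c; rewrite !E; case: ifP; rewrite ?cards0 ?Pm.
- by move=> j x _; rewrite E Pm.
- by move=> i j x y xP yP _; apply: Pnear.
Qed.

Lemma cellular_union (n k B : nat) (near : 'I_k -> 'I_n -> 'I_k -> 'I_n -> Prop)
    (P Q S : 'I_k -> {set 'I_n}) :
  (forall j, P j = Q j :|: S j) -> (forall j, [disjoint Q j & S j]) ->
  cellular B near Q -> cellular B near S -> cellular B near P.
Proof.
move=> PE dis [N1 [l1 [b1 e1 c1 n1]]] [N2 [l2 [b2 e2 c2 n2]]].
(* Labels on [S] are shifted by [N1], the bound for labels on [Q], so that no cell of one family is
   merged with a cell of the other. *)
pose lab j x := if x \in Q j then l1 j x else (N1 + l2 j x)%N.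
have SQ j x : x \in S j -> x \in Q j = false.
  by move=> xS; apply/negbTE; rewrite (disjointFl (dis j)).
have lQ j c : [set x in P j | lab j x == c] =
    if (c < N1)%N then [set x in Q j | l1 j x == c] else [set x in S j | l2 j x == c - N1]%N.
  case: ltnP => cN; apply/setP => x; rewrite !inE PE inE /lab.
    case: (boolP (x \in Q j)) => //= _.
    by case: (x \in S j) => //=; apply/negbTE; lia.
  case: (boolP (x \in Q j)) => [xQ|xQ] /=.
    rewrite (disjointFr (dis j)) //=; apply/negbTE.
    by have := b1 _ _ xQ; lia.
  by case: (x \in S j) => //=; apply/eqP/eqP; lia.
exists (N1 + N2)%N, lab; split.
- move=> j x; rewrite PE inE /lab; case: (boolP (x \in Q j)) => /= [/b1|_ /b2]; lia.
- by move=> i j c; rewrite !lQ; case: ifP.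
- move=> j x xP; have := xP; rewrite {1}PE inE => /orP[xQ|xS]; rewrite lQ /lab.
    by rewrite xQ b1 // c1.
  by rewrite SQ // ltnNge leq_addr /= addKn c2.
- move=> i j x y; rewrite !PE !inE => /orP[xP|xP] /orP[yP|yP]; rewrite /lab.
  + by rewrite xP yP; apply: n1.
  + by rewrite xP SQ //; have := b1 _ _ xP; lia.
  + by rewrite yP SQ //; have := b1 _ _ yP; lia.
  + by rewrite !SQ // => /addnI; apply: n2.
Qed.

Definition rect (n : nat) (s : 'S_n) (a b c d : nat) : {set 'I_n} :=
  [set x : 'I_n | (a <= x < b)%N && (c <= s x < d)%N].

Lemma nat_ivt (F : nat -> nat) (a b v : nat) : (a <= b)%N -> (F a <= v <= F b)%N ->
  (forall t, F t.+1 <= (F t).+1)%N -> exists2 t, (a <= t <= b)%N & F t = v.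
Proof.
move=> ab /andP[av vb] F1; move: vb; rewrite -(subnKC ab).
elim: (b - a)%N => [|i IH] vb.
  by exists a; [rewrite leqnn addn0 leqnn | move: vb; rewrite addn0; lia].
have [vi|vi] := leqP v (F (a + i)%N).
  by case: (IH vi) => t tP tv; exists t => //; lia.
exists (a + i.+1)%N; first lia.
by have := F1 (a + i)%N; rewrite -addnS in vb *; lia.
Qed.

(** A permutation has one point per column, so the count grows by at most one as the cut moves and
    takes every intermediate value. Exact counts are what keep corresponding cells equinumerous. *)
Lemma rect_split_x (n : nat) (s : 'S_n) (a b c d m m' : nat) :
  (a <= b)%N -> #|rect s a b c d| = m -> (m' <= m)%N ->
  exists2 t, (a <= t <= b)%N &
    [/\ #|rect s a t c d| = m', #|rect s t b c d| = (m - m')%N,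
        rect s a b c d = rect s a t c d :|: rect s t b c d &
        [disjoint rect s a t c d & rect s t b c d]].
Proof.
move=> ab cm m'm.
have [||t /andP[at_ tb] tE] := @nat_ivt (fun t => #|rect s a t c d|) a b m' ab.
- by rewrite cm m'm andbT (_ : rect _ _ _ _ _ = finset.set0) ?cards0 //; apply/setP => x; rewrite !inE; lia.
- move=> t; rewrite -[X in (_ <= X)%N]addn1.
  apply: (@leq_trans (#|rect s a t c d| + #|[set x : 'I_n | (t <= x + 0 < t + 1)%N]|)%N).
    apply: leq_trans (leq_card_setU _ _); apply: subset_leq_card.
    by apply/fintype.subsetP => x; rewrite !inE; lia.
  by rewrite leq_add2l card_ord_interval.
have U : rect s a b c d = rect s a t c d :|: rect s t b c d.
  by apply/setP => x; rewrite !inE; lia.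
have Dj : [disjoint rect s a t c d & rect s t b c d].
  by rewrite -finset.setI_eq0; apply/eqP/setP => x; rewrite !inE; lia.
exists t; [lia | split=> //].
have := leq_card_setU (rect s a t c d) (rect s t b c d).
by move=> [_]; rewrite Dj -U cm tE => /eqP ->; rewrite addKn.
Qed.

Lemma card_rect_inv (n : nat) (s : 'S_n) (a b c d : nat) :
  rect s a b c d = s @^-1: rect (s^-1)%g c d a b.
Proof. by apply/setP => x; rewrite !inE permK andbC. Qed.

Lemma rect_split_y (n : nat) (s : 'S_n) (a b c d m m' : nat) :
  (c <= d)%N -> #|rect s a b c d| = m -> (m' <= m)%N ->
  exists2 t, (c <= t <= d)%N &
    [/\ #|rect s a b c t| = m', #|rect s a b t d| = (m - m')%N,
        rect s a b c d = rect s a b c t :|: rect s a b t d &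
        [disjoint rect s a b c t & rect s a b t d]].
Proof.
(* Values are the positions of the inverse permutation, which reduces horizontal cuts to vertical
   ones. *)
have cE c' d' : #|rect s a b c' d'| = #|rect (s^-1)%g c' d' a b|.
  by rewrite card_rect_inv on_card_preimset //; exists (s^-1)%g => x _; rewrite ?permK ?permKV.
move=> cd cm m'm.
have [t tP [t1 t2 t3 t4]] := rect_split_x cd (etrans (esym (cE _ _)) cm) m'm.
exists t => //; split; rewrite ?cE //.
  by rewrite !(card_rect_inv s) t3 preimsetU.
rewrite -finset.setI_eq0 !(card_rect_inv s) -preimsetI.
by move: t4; rewrite -finset.setI_eq0 => /eqP ->; rewrite preimset0.
Qed.

(** [A], [A'] and [H] are the ideal ends and the ideal transverse side, [a], [b] and [h] the actual
    ones, and [t] the actual cut leaving the fraction [rho] of the points. The new drift is the old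
    one plus a term that does not involve [m]. *)
Lemma cut_shift (R : rcfType) (N L m m' a b t h A A' H dl rho : R) :
  0 < N -> 0 <= L -> 0 <= m -> N * m <= 3 * H ^+ 2 -> 0 < H -> 0 <= dl -> 4 * dl <= H ->
  H - 2 * dl <= h ->
  `|m - (b - a) * h / N| <= 16 * Num.sqrt (m * L) ->
  `|m' - (t - a) * h / N| <= 16 * Num.sqrt (m * L) ->
  0 <= rho <= 1 -> m' = rho * m -> `|a - A| <= dl -> `|b - A'| <= dl ->
  `|t - (A + rho * (A' - A))| <= dl + 112 * Num.sqrt (N * L).
Proof.
move=> N0 L0 m0 NmH H0 dl0 dlH hH mE m'E /andP[rho0 rho1] mm aA bA.
set sm := Num.sqrt (m * L) in mE m'E; set sn := Num.sqrt (N * L).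
have sm0 : 0 <= sm by exact: sqrtr_ge0.
have sn0 : 0 <= sn by exact: sqrtr_ge0.
have sm2 : sm ^+ 2 = m * L by rewrite sqr_sqrtr // mulr_ge0.
have sn2 : sn ^+ 2 = N * L by rewrite sqr_sqrtr // mulr_ge0 // ltW.
have h0 : 0 < h by lra.
have Nmh : N * m <= 12 * h ^+ 2.
  have : H ^+ 2 <= (2 * h) ^+ 2 by rewrite ler_sqr ?nnegrE; lra.
  rewrite exprMn; lra.
(* Since [h >= H / 2], [N * m <= 3 * H ^ 2] becomes [N * m <= 12 * h ^ 2]; the constant 112 exceeds
   32 sqrt 12. *)
have key : 32 * N * sm <= 112 * sn * h.
  rewrite -ler_sqr ?nnegrE; last 2 first.
  - by rewrite !mulr_ge0 // ltW.
  - by rewrite !mulr_ge0 // ltW.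
  rewrite !exprMn sm2 sn2.
  have : (N * L) * (N * m) <= (N * L) * (12 * h ^+ 2) by rewrite ler_wpM2l // mulr_ge0 // ltW.
  have : 0 <= N * L * h ^+ 2 by rewrite !mulr_ge0 // ?sqr_ge0 // ltW.
  lra.
have scale x y : `|x - y * h / N| <= 16 * sm -> `|N * x - y * h| <= 16 * N * sm.
  move=> xy; have -> : N * x - y * h = N * (x - y * h / N) by field; rewrite gt_eqF.
  by rewrite normrM gtr0_norm //; have := ler_wpM2l (ltW N0) xy; lra.
have {}mE := scale _ _ mE; have {}m'E := scale _ _ m'E.
have E1 : `|(t - a - rho * (b - a)) * h| <= 112 * sn * h.
  apply: le_trans key.
  have -> : (t - a - rho * (b - a)) * h =
      - (N * m' - (t - a) * h) + rho * (N * m - (b - a) * h) by rewrite mm; ring.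
  apply: le_trans (ler_normD _ _) _; rewrite normrN normrM (ger0_norm rho0).
  have : rho * `|N * m - (b - a) * h| <= 1 * (16 * N * sm) by apply: ler_pM.
  lra.
have {}E1 : `|t - a - rho * (b - a)| <= 112 * sn.
  by move: E1; rewrite normrM (gtr0_norm h0) ler_pM2r.
(* The drifts of the two ends enter through a convex combination, so the old error is carried over
   and not doubled at each level. *)
have E2 : `|(1 - rho) * (a - A) + rho * (b - A')| <= dl.
  apply: le_trans (ler_normD _ _) _.
  have rho1' : 0 <= 1 - rho by lra.
  rewrite !normrM (ger0_norm rho0) (ger0_norm rho1').
  have := ler_wpM2l rho1' aA; have := ler_wpM2l rho0 bA; lra.
have -> : t - (A + rho * (A' - A)) =
    (t - a - rho * (b - a)) + ((1 - rho) * (a - A) + rho * (b - A')) by ring.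
apply: le_trans (ler_normD _ _) _; lra.
Qed.

(** The side is at least sqrt (N m / 3), and 800 exceeds 448 sqrt 3 with 448 = 4 * 112. This is the
    source of the lower bound of order L^3 on cell sizes. *)
Lemma shift_le_side (R : rcfType) (N L m W dl : R) :
  0 <= N -> 0 <= L -> 0 <= W -> N * m <= 3 * W ^+ 2 -> 800 ^+ 2 * L ^+ 3 <= m ->
  dl <= 112 * Num.sqrt (N * L) * L -> 4 * dl <= W.
Proof.
move=> N0 L0 W0 NW Lm dlL; set sn := Num.sqrt _ in dlL.
have sn0 : 0 <= sn by exact: sqrtr_ge0.
have sn2 : sn ^+ 2 = N * L by rewrite sqr_sqrtr // mulr_ge0.
apply: (@le_trans _ _ (448 * sn * L)); first lra.
rewrite -ler_sqr ?nnegrE ?mulr_ge0 // !exprMn sn2.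
have : N * (800 ^+ 2 * L ^+ 3) <= N * m by rewrite ler_wpM2l.
have : 0 <= N * L ^+ 3 by rewrite mulr_ge0 // exprn_ge0.
have -> : 448 ^+ 2 * (N * L) * L ^+ 2 = 448 ^+ 2 * (N * L ^+ 3) by ring.
lra.
Qed.

(** The scale [m] is a parameter separate from the rectangle, so one bound serves a cell and the
    pieces cut from it. The factor 4 allows both sides of a drifted cell to be twice the ideal ones;
    [256 * L <= m] keeps the allowed deviation at most [m], the range of the tail bound. *)
Definition balanced (R : realType) (n L : nat) (s : 'S_n) : Prop :=
  forall a b c d m : nat, (a <= b <= n)%N -> (c <= d <= n)%N ->
    ((b - a) * (d - c) <= 4 * n * m)%N -> (256 * L <= m <= n)%N ->
    `|#|rect s a b c d|%:R - (b%:R - a%:R) * (d%:R - c%:R) / n%:R| <=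
      16 * Num.sqrt (m%:R * L%:R) :> R.

Definition close_points (n k D : nat) (s : 'I_k -> 'S_n) (i : 'I_k) (x : 'I_n) (j : 'I_k) (y : 'I_n) :=
  [/\ x <= y + D, y <= x + D, s i x <= s j y + D & s j y <= s i x + D]%N.

(* The rectangle with real corners [X0, Y0] and [X1, Y1] is the ideal cell, common to all the
   permutations, from which the actual cells drift by at most [dl]. *)
Definition tracks (R : realType) (n k m : nat) (dl : R) (s : 'I_k -> 'S_n)
    (a b c d : 'I_k -> nat) (X0 X1 Y0 Y1 : R) : Prop :=
  [/\ forall j, [/\ a j <= b j <= n, c j <= d j <= n & #|rect (s j) (a j) (b j) (c j) (d j)| = m]%N,
      [/\ X0 < X1, Y0 < Y1 & (X1 - X0) * (Y1 - Y0) = n%:R * m%:R],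
      X1 - X0 <= 3 * (Y1 - Y0) /\ Y1 - Y0 <= 3 * (X1 - X0) &
      forall j, [/\ `|(a j)%:R - X0| <= dl, `|(b j)%:R - X1| <= dl,
                    `|(c j)%:R - Y0| <= dl & `|(d j)%:R - Y1| <= dl]].

Lemma side_ge (R : realDomainType) (x y X Y dl : R) :
  `|x - X| <= dl -> `|y - Y| <= dl -> Y - X - 2 * dl <= y - x.
Proof. by move=> /ler_normlP[? ?] /ler_normlP[? ?]; lra. Qed.

Section KdTree.
Variables (R : realType) (n k L B D : nat) (s : 'I_k -> 'S_n).
Hypotheses (n0 : (0 < n)%N) (L0 : (0 < L)%N) (hB : 800 ^+ 2 * L%:R ^+ 3 <= B%:R :> R)
  (hD : (14 * (n * B) <= D ^ 2)%N) (bal : forall j, balanced R L (s j)).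

Let sn : R := Num.sqrt (n%:R * L%:R).
Let N0 : 0 < n%:R :> R. Proof. by rewrite ltr0n. Qed.

Lemma tracks_sides m dl a b c d X0 X1 Y0 Y1 :
  tracks m dl s a b c d X0 X1 Y0 Y1 -> (B <= m)%N -> dl <= 112 * sn * L%:R ->
  [/\ 4 * dl <= X1 - X0, 4 * dl <= Y1 - Y0, n%:R * m%:R <= 3 * (X1 - X0) ^+ 2 &
      n%:R * m%:R <= 3 * (Y1 - Y0) ^+ 2].
Proof.
move=> [_ [X01 Y01 area] [asp1 asp2] _] Bm dlL.
have LN : 0 <= L%:R :> R by [].
have mB : 800 ^+ 2 * L%:R ^+ 3 <= m%:R :> R by apply: le_trans hB _; rewrite ler_nat.
have mW : n%:R * m%:R <= 3 * (X1 - X0) ^+ 2.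
  rewrite -area; have : (X1 - X0) * (Y1 - Y0) <= (X1 - X0) * (3 * (X1 - X0)).
    by rewrite ler_wpM2l //; lra.
  lra.
have mH : n%:R * m%:R <= 3 * (Y1 - Y0) ^+ 2.
  rewrite -area; have : (X1 - X0) * (Y1 - Y0) <= 3 * (Y1 - Y0) * (Y1 - Y0).
    by rewrite ler_wpM2r //; lra.
  lra.
split=> //; apply: (shift_le_side (ltW N0) LN _ _ mB dlL) => //; lra.
Qed.

Lemma tracks_leaf m dl a b c d X0 X1 Y0 Y1 :
  tracks m dl s a b c d X0 X1 Y0 Y1 -> (B <= m < 2 * B)%N -> dl <= 112 * sn * L%:R ->
  cellular B (close_points D s) (fun j => rect (s j) (a j) (b j) (c j) (d j)).
Proof.
move=> tr /andP[Bm mB] dlL; have [dW dH mW mH] := tracks_sides tr Bm dlL.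
case: tr => [cnt [X01 Y01 area] [asp1 asp2] cl].
have D0 : 0 <= D%:R :> R by [].
have hDR : 14 * (n%:R * B%:R) <= D%:R ^+ 2 :> R.
  by rewrite -natrM -natrX -(natrM _ 14) ler_nat.
have mBR : n%:R * m%:R <= 2 * (n%:R * B%:R) :> R.
  by rewrite mulrCA ler_wpM2l // -natrM ler_nat ltnW.
(* Drift at the two ends lengthens a side by at most half. With u^2 <= 3 n m <= 6 n B this gives
   (9/4) * 6 = 13.5, rounded up to 14 in [hD]. *)
have side (u : R) : 0 < u -> u ^+ 2 <= 3 * (n%:R * m%:R) -> 3 / 2 * u <= D%:R.
  move=> u0 u2; rewrite -ler_sqr ?nnegrE //; last lra.
  rewrite exprMn; have : (3 / 2 : R) ^+ 2 = 9 / 4 by field.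
  have nB0 : 0 <= n%:R * B%:R :> R by rewrite mulr_ge0.
  by move=> ->; lra.
have W2 : 3 / 2 * (X1 - X0) <= D%:R.
  apply: side; first lra.
  rewrite -area; have : (X1 - X0) * (X1 - X0) <= (X1 - X0) * (3 * (Y1 - Y0)).
    by rewrite ler_wpM2l //; lra.
  lra.
have H2 : 3 / 2 * (Y1 - Y0) <= D%:R.
  apply: side; first lra.
  rewrite -area; have : (Y1 - Y0) * (Y1 - Y0) <= 3 * (X1 - X0) * (Y1 - Y0).
    by rewrite ler_wpM2r //; lra.
  lra.
have close (u v lo hi lo' hi' : nat) (Z0 Z1 : R) : 3 / 2 * (Z1 - Z0) <= D%:R ->
    4 * dl <= Z1 - Z0 -> (lo <= u < hi)%N -> (lo' <= v < hi')%N ->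
    `|lo%:R - Z0| <= dl -> `|hi'%:R - Z1| <= dl -> (v <= u + D)%N.
  move=> ZD dZ /andP[lou _] /andP[_ vhi] /ler_normlP[l1 l2] /ler_normlP[l3 l4].
  rewrite -(ler_nat R) natrD.
  have : lo%:R <= u%:R :> R by rewrite ler_nat.
  have : v%:R <= hi'%:R :> R by rewrite ler_nat ltnW.
  lra.
apply: (cellular_single Bm) => [j|i j x y]; first by case: (cnt j).
rewrite !inE => /andP[xa xc] /andP[ya yc].
have [ai bi ci di] := cl i; have [aj bj cj dj] := cl j.
split.
- exact: (close _ _ _ _ _ _ _ _ W2 dW ya xa).
- exact: (close _ _ _ _ _ _ _ _ W2 dW xa ya).
- exact: (close _ _ _ _ _ _ _ _ H2 dH yc xc).
- exact: (close _ _ _ _ _ _ _ _ H2 dH xc yc).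
Qed.

Lemma tracks_area m dl a b c d X0 X1 Y0 Y1 j :
  tracks m dl s a b c d X0 X1 Y0 Y1 -> (B <= m)%N -> dl <= 112 * sn * L%:R ->
  ((b j - a j) * (d j - c j) <= 4 * n * m)%N.
Proof.
move=> tr Bm dlL; have [dW dH _ _] := tracks_sides tr Bm dlL.
case: tr => [cnt [X01 Y01 area] _ cl].
have [/andP[ab _] /andP[cd _] _] := cnt j.
have [/ler_normlP[a1 a2] /ler_normlP[b1 b2] /ler_normlP[c1 c2] /ler_normlP[d1 d2]] := cl j.
rewrite -(ler_nat R) !natrM !natrB //.
have ba0 : 0 <= (b j)%:R - (a j)%:R :> R by rewrite subr_ge0 ler_nat.
have dc0 : 0 <= (d j)%:R - (c j)%:R :> R by rewrite subr_ge0 ler_nat.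
have : ((b j)%:R - (a j)%:R) * ((d j)%:R - (c j)%:R) <= (2 * (X1 - X0)) * (2 * (Y1 - Y0)).
  by apply: ler_pM => //; lra.
lra.
Qed.

Lemma tracks_balanced m dl a b c d X0 X1 Y0 Y1 j a' b' c' d' m' :
  tracks m dl s a b c d X0 X1 Y0 Y1 -> (B <= m <= n)%N -> dl <= 112 * sn * L%:R ->
  (a j <= a' <= b')%N -> (b' <= b j)%N -> (c j <= c' <= d')%N -> (d' <= d j)%N ->
  #|rect (s j) a' b' c' d'| = m' ->
  `|m'%:R - (b'%:R - a'%:R) * (d'%:R - c'%:R) / n%:R| <= 16 * Num.sqrt (m%:R * L%:R) :> R.
Proof.
move=> tr /andP[Bm mn] dlL aa bb cc dd <-.
have ar := tracks_area j tr Bm dlL.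
case: tr => [cnt _ _ _]; have [/andP[ab bn] /andP[cd dn] _] := cnt j.
have LB : (256 * L <= B)%N.
  have L1 : 1 <= L%:R :> R by rewrite ler1n.
  rewrite -(ler_nat R) natrM; apply: le_trans hB.
  have : L%:R * 1 <= L%:R * L%:R ^+ 2 :> R by rewrite ler_wpM2l // exprn_ege1.
  by rewrite -exprS; lra.
apply: bal; [lia | lia | | lia].
by apply: leq_trans ar; apply: leq_mul; lia.
Qed.

(** The ideal cell is cut in the exact ratio of the point counts, which preserves the relation
    between its area and its number of points. Rounding [m./2] costs most at m = 3, where the ratio
    is 1/3. *)
Lemma half_ratio m : (2 <= m)%N -> exists rho : R,
  [/\ 1 / 3 <= rho, rho <= 1 / 2, 0 <= rho <= 1, (m./2)%:R = rho * m%:R & (m - m./2)%:R = (1 - rho) * m%:R].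
Proof.
move=> m2; have m0 : 0 < m%:R :> R by rewrite ltr0n; lia.
have m3 : m%:R <= 3 * (m./2)%:R :> R by rewrite -(natrM _ 3) ler_nat; lia.
have m2' : 2 * (m./2)%:R <= m%:R :> R by rewrite -(natrM _ 2) ler_nat; lia.
have E : (m./2)%:R = (m./2)%:R / m%:R * m%:R :> R by rewrite divfK // gt_eqF.
have r1 : 1 / 3 <= (m./2)%:R / m%:R :> R by rewrite ler_pdivlMr //; lra.
have r2 : (m./2)%:R / m%:R <= 1 / 2 :> R by rewrite ler_pdivrMr //; lra.
exists ((m./2)%:R / m%:R); split=> //.
- by apply/andP; split; lra.
- by rewrite natrB ?mulrBl ?mul1r -?E //; lia.
Qed.

(** Cutting the longer side into fractions of at least 1/3 keeps the aspect ratio at most 3. *)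
Lemma split_ratio (rho W H : R) : 1 / 3 <= rho -> rho <= 1 / 2 -> 0 < W -> H <= W -> W <= 3 * H ->
  [/\ 0 < rho * W, 0 < (1 - rho) * W & [/\ rho * W <= 3 * H, H <= 3 * (rho * W),
     (1 - rho) * W <= 3 * H & H <= 3 * ((1 - rho) * W)]].
Proof.
move=> r1 r2 W0 HW WH.
have l1 : 1 / 3 * W <= rho * W by rewrite ler_pM2r.
have l2 : rho * W <= 1 / 2 * W by rewrite ler_pM2r.
by split; [lra | lra | split; lra].
Qed.

Lemma kd_step_x m dl a b c d X0 X1 Y0 Y1 :
  tracks m dl s a b c d X0 X1 Y0 Y1 -> (B <= m <= n)%N -> (2 <= m)%N -> 0 <= dl ->
  dl <= 112 * sn * L%:R -> Y1 - Y0 <= X1 - X0 ->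
  exists (t : 'I_k -> nat) (T : R),
    [/\ tracks m./2 (dl + 112 * sn) s a t c d X0 T Y0 Y1,
        tracks (m - m./2) (dl + 112 * sn) s t b c d T X1 Y0 Y1 &
        forall j, rect (s j) (a j) (b j) (c j) (d j) =
          rect (s j) (a j) (t j) (c j) (d j) :|: rect (s j) (t j) (b j) (c j) (d j) /\
        [disjoint rect (s j) (a j) (t j) (c j) (d j) & rect (s j) (t j) (b j) (c j) (d j)]].
Proof.
move=> tr Bmn m2 dl0 dlL HW; have /andP[Bm mn] := Bmn.
have [dW dH mW mH] := tracks_sides tr Bm dlL.
have bd := tracks_balanced tr Bmn dlL.
have [rho [rho1 rho2 r01 mE1 mE2]] := half_ratio m2.
case: tr => [cnt [X01 Y01 area] [asp1 asp2] cl].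
have m'm : (m./2 <= m)%N by clear; lia.
have /fin_all_exists2[t tP tQ] : forall j, exists2 t, (a j <= t <= b j)%N &
    [/\ #|rect (s j) (a j) t (c j) (d j)| = m./2, #|rect (s j) t (b j) (c j) (d j)| = (m - m./2)%N,
      rect (s j) (a j) (b j) (c j) (d j) =
        rect (s j) (a j) t (c j) (d j) :|: rect (s j) t (b j) (c j) (d j) &
      [disjoint rect (s j) (a j) t (c j) (d j) & rect (s j) t (b j) (c j) (d j)]].
  move=> j; have [/andP[ab bn] /andP[cd dn] cm] := cnt j.
  exact: rect_split_x.
have W0 : 0 < X1 - X0 by rewrite subr_gt0.
have [w1 w2 [w3 w4 w5 w6]] := split_ratio rho1 rho2 W0 HW asp1.
have sn0 : 0 <= 112 * sn by rewrite mulr_ge0 // sqrtr_ge0.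
have grow u : u <= dl -> u <= dl + 112 * sn by move=> u_dl; rewrite ler_wpDr.
have TE1 : X0 + rho * (X1 - X0) - X0 = rho * (X1 - X0) by ring.
have TE2 : X1 - (X0 + rho * (X1 - X0)) = (1 - rho) * (X1 - X0) by ring.
have tT j : `|(t j)%:R - (X0 + rho * (X1 - X0))| <= dl + 112 * sn.
  have [/andP[ab bn] /andP[cd dn] cm] := cnt j; have [ca cb cc cd'] := cl j.
  have [t1 _ _ _] := tQ j; have /andP[at_ tb] := tP j.
  (* Discrepancy is used for the whole cell and for its left part, both at the scale [m] of the
     whole cell. *)
  have b1 := bd j (a j) (b j) (c j) (d j) m; rewrite !leqnn ab cd in b1.
  have b2 := bd j (a j) (t j) (c j) (d j) m./2; rewrite !leqnn at_ cd in b2.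
  apply: (cut_shift N0 _ _ mH _ dl0 dH _ (b1 isT isT isT isT cm) (b2 isT tb isT isT t1)
    r01 mE1 ca cb) => //; first by rewrite subr_gt0.
  exact: side_ge cc cd'.
exists t, (X0 + rho * (X1 - X0)); split; last by move=> j; case: (tQ j).
  split.
  - move=> j; have [/andP[ab bn] cd cm] := cnt j; have [? _ _ _] := tQ j.
    by have /andP[at_ tb] := tP j; rewrite at_ (leq_trans tb bn).
  - by rewrite -subr_gt0 TE1; split=> //; rewrite -mulrA area mulrCA mE1.
  - by rewrite TE1.
  - by move=> j; have [ca cb cc cd] := cl j; split=> //; apply: grow.
split.
- move=> j; have [/andP[ab bn] cd cm] := cnt j; have [_ ? _ _] := tQ j.
  by have /andP[at_ tb] := tP j; rewrite tb bn.
- by rewrite -subr_gt0 TE2; split=> //; rewrite -mulrA area mulrCA mE2.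
- by rewrite TE2.
- by move=> j; have [ca cb cc cd] := cl j; split=> //; apply: grow.
Qed.

Lemma kd_step_y m dl a b c d X0 X1 Y0 Y1 :
  tracks m dl s a b c d X0 X1 Y0 Y1 -> (B <= m <= n)%N -> (2 <= m)%N -> 0 <= dl ->
  dl <= 112 * sn * L%:R -> X1 - X0 <= Y1 - Y0 ->
  exists (t : 'I_k -> nat) (T : R),
    [/\ tracks m./2 (dl + 112 * sn) s a b c t X0 X1 Y0 T,
        tracks (m - m./2) (dl + 112 * sn) s a b t d X0 X1 T Y1 &
        forall j, rect (s j) (a j) (b j) (c j) (d j) =
          rect (s j) (a j) (b j) (c j) (t j) :|: rect (s j) (a j) (b j) (t j) (d j) /\
        [disjoint rect (s j) (a j) (b j) (c j) (t j) & rect (s j) (a j) (b j) (t j) (d j)]].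
Proof.
move=> tr Bmn m2 dl0 dlL HW; have /andP[Bm mn] := Bmn.
have [dW dH mW mH] := tracks_sides tr Bm dlL.
have bd := tracks_balanced tr Bmn dlL.
have [rho [rho1 rho2 r01 mE1 mE2]] := half_ratio m2.
case: tr => [cnt [X01 Y01 area] [asp1 asp2] cl].
have m'm : (m./2 <= m)%N by clear; lia.
have /fin_all_exists2[t tP tQ] : forall j, exists2 t, (c j <= t <= d j)%N &
    [/\ #|rect (s j) (a j) (b j) (c j) t| = m./2, #|rect (s j) (a j) (b j) t (d j)| = (m - m./2)%N,
      rect (s j) (a j) (b j) (c j) (d j) =
        rect (s j) (a j) (b j) (c j) t :|: rect (s j) (a j) (b j) t (d j) &
      [disjoint rect (s j) (a j) (b j) (c j) t & rect (s j) (a j) (b j) t (d j)]].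
  move=> j; have [/andP[ab bn] /andP[cd dn] cm] := cnt j.
  exact: rect_split_y.
have W0 : 0 < Y1 - Y0 by rewrite subr_gt0.
have [w1 w2 [w3 w4 w5 w6]] := split_ratio rho1 rho2 W0 HW asp2.
have sn0 : 0 <= 112 * sn by rewrite mulr_ge0 // sqrtr_ge0.
have grow u : u <= dl -> u <= dl + 112 * sn by move=> u_dl; rewrite ler_wpDr.
have TE1 : Y0 + rho * (Y1 - Y0) - Y0 = rho * (Y1 - Y0) by ring.
have TE2 : Y1 - (Y0 + rho * (Y1 - Y0)) = (1 - rho) * (Y1 - Y0) by ring.
have tT j : `|(t j)%:R - (Y0 + rho * (Y1 - Y0))| <= dl + 112 * sn.
  have [/andP[ab bn] /andP[cd dn] cm] := cnt j; have [ca cb cc cd'] := cl j.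
  have [t1 _ _ _] := tQ j; have /andP[ct td] := tP j.
  have b1 := bd j (a j) (b j) (c j) (d j) m; rewrite !leqnn ab cd in b1.
  have b2 := bd j (a j) (b j) (c j) (t j) m./2; rewrite !leqnn ct ab in b2.
  have {}b1 := b1 isT isT isT isT cm; have {}b2 := b2 isT isT isT td t1.
  rewrite (mulrC (_ - _)) in b1; rewrite (mulrC (_ - _)) in b2.
  apply: (cut_shift N0 _ _ mW _ dl0 dW _ b1 b2 r01 mE1 cc cd') => //; first by rewrite subr_gt0.
  exact: side_ge ca cb.
exists t, (Y0 + rho * (Y1 - Y0)); split; last by move=> j; case: (tQ j).
  split.
  - move=> j; have [ab /andP[cd dn] cm] := cnt j; have [? _ _ _] := tQ j.
    by have /andP[ct td] := tP j; rewrite ct (leq_trans td dn).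
  - by rewrite -(subr_gt0 Y0) TE1; split=> //; rewrite mulrCA area mulrCA mE1.
  - by rewrite TE1.
  - by move=> j; have [ca cb cc cd] := cl j; split=> //; apply: grow.
split.
- move=> j; have [ab /andP[cd dn] cm] := cnt j; have [_ ? _ _] := tQ j.
  by have /andP[ct td] := tP j; rewrite td dn.
- by rewrite -(subr_gt0 _ Y1) TE2; split=> //; rewrite mulrCA area mulrCA mE2.
- by rewrite TE2.
- by move=> j; have [ca cb cc cd] := cl j; split=> //; apply: grow.
Qed.

(** [i] counts the levels still available: the [L - i] cuts already made account for the drift, and
    [m <= 2 ^ i] survives halving even when the larger half is rounded up. *)
Lemma kd_cells i m a b c d X0 X1 Y0 Y1 : (i <= L)%N -> (B <= m <= n)%N -> (m <= 2 ^ i)%N ->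
  tracks m (112 * sn * (L%:R - i%:R)) s a b c d X0 X1 Y0 Y1 ->
  cellular B (close_points D s) (fun j => rect (s j) (a j) (b j) (c j) (d j)).
Proof.
have sn0 : 0 <= 112 * sn by rewrite mulr_ge0 // sqrtr_ge0.
have B2 : (1 <= B)%N.
  rewrite -(ler_nat R); apply: le_trans hB.
  have : 1 <= L%:R ^+ 3 :> R by rewrite exprn_ege1 // ler1n.
  lra.
elim: i m a b c d X0 X1 Y0 Y1 => [|i IH] m a b c d X0 X1 Y0 Y1 iL Bmn mi tr.
  (* At level 0, [m <= 1 < 2 * B], so the cell is a leaf. *)
  by apply: (tracks_leaf tr); [clear -Bmn mi B2; lia | rewrite subr0].
have dlE : 112 * sn * (L%:R - i%:R) = 112 * sn * (L%:R - i.+1%:R) + 112 * sn.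
  by rewrite -[i.+1%:R]natr1; ring.
have dl0 : 0 <= 112 * sn * (L%:R - i.+1%:R) by rewrite mulr_ge0 // subr_ge0 ler_nat.
have dlL : 112 * sn * (L%:R - i.+1%:R) <= 112 * sn * L%:R by rewrite ler_wpM2l // gerBl.
have /andP[Bm mn] := Bmn.
have [mB|mB] := ltnP m (2 * B)%N; first by apply: (tracks_leaf tr) => //; rewrite Bm.
have m1 : (B <= m./2 <= n)%N by clear -mB mn; lia.
have m2 : (B <= m - m./2 <= n)%N by clear -mB mn; lia.
have m3 : (m./2 <= 2 ^ i)%N by rewrite expnS in mi; clear -mi; lia.
have m4 : (m - m./2 <= 2 ^ i)%N by rewrite expnS in mi; clear -mi; lia.
have m5 : (2 <= m)%N by clear -mB B2; lia.
have [HW|/ltW HW] := leP (Y1 - Y0) (X1 - X0).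
  have [t [T [t1 t2 tU]]] := kd_step_x tr Bmn m5 dl0 dlL HW; rewrite -dlE in t1 t2.
  exact: (cellular_union (fun j => (tU j).1) (fun j => (tU j).2)
    (IH _ _ _ _ _ _ _ _ _ (ltnW iL) m1 m3 t1) (IH _ _ _ _ _ _ _ _ _ (ltnW iL) m2 m4 t2)).
have [t [T [t1 t2 tU]]] := kd_step_y tr Bmn m5 dl0 dlL HW; rewrite -dlE in t1 t2.
exact: (cellular_union (fun j => (tU j).1) (fun j => (tU j).2)
  (IH _ _ _ _ _ _ _ _ _ (ltnW iL) m1 m3 t1) (IH _ _ _ _ _ _ _ _ _ (ltnW iL) m2 m4 t2)).
Qed.

Lemma cellular_of_balanced : (B <= n)%N -> (n <= 2 ^ L)%N ->
  cellular B (close_points D s) (fun=> [set: 'I_n]).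
Proof.
move=> Bn nL.
have E j : rect (s j) 0 n 0 n = [set: 'I_n].
  by apply/setP => x; rewrite !inE !ltn_ord.
have -> : (fun=> [set: 'I_n]) = (fun j => rect (s j) 0 n 0 n) by apply/funext => j; rewrite E.
have Bn' : (B <= n <= n)%N by rewrite Bn leqnn.
apply: (@kd_cells L n (fun=> 0%N) (fun=> n) (fun=> 0%N) (fun=> n) 0 n%:R 0 n%:R) => //.
rewrite subrr mulr0; split.
- by move=> j; rewrite E cardsT card_ord leqnn.
- by rewrite subr0.
- by rewrite subr0; have := ltW N0; split; lra.
- by move=> j; rewrite !subrr normr0.
Qed.
End KdTree.

(** * Discrepancy of random permutations *)

(** Negative dependence by symmetrisation: averaging over the transpositions of [a] with every [y]
    replaces the indicator at [a] by the mean density of [J]. The bound [-1 <= u] keeps the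
    untouched factors nonnegative. *)
Lemma sum_prod_perm_step (R : realDomainType) (n : nat) (I J : {set 'I_n}) (a : 'I_n) (u : R) :
  a \notin I -> -1 <= u ->
  n%:R * \sum_(s : 'S_n) u * (s a \in J)%:R * \prod_(x in I) (1 + u * (s x \in J)%:R) <=
  u * #|J|%:R * \sum_(s : 'S_n) \prod_(x in I) (1 + u * (s x \in J)%:R).
Proof.
move=> aI u1; pose g (s : 'S_n) := \prod_(x in I) (1 + u * (s x \in J)%:R).
have E y : \sum_(s : 'S_n) u * (s a \in J)%:R * g s =
    \sum_(s : 'S_n) u * (s y \in J)%:R * g (tperm a y * s)%g.
  rewrite (reindex_inj (mulgI (tperm a y))) /=; apply: eq_bigr => s _.
  by rewrite permM tpermL.
have -> : n%:R * \sum_(s : 'S_n) u * (s a \in J)%:R * g s =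
    \sum_(y : 'I_n) \sum_(s : 'S_n) u * (s y \in J)%:R * g (tperm a y * s)%g.
  rewrite -(eq_bigr _ (fun y _ => E y)).
  by rewrite sumr_const card_ord mulr_natl.
rewrite exchange_big /= mulr_sumr; apply: ler_sum => s _.
have -> : u * #|J|%:R * g s = \sum_(y : 'I_n) u * (s y \in J)%:R * g s.
  rewrite -mulr_suml -mulr_sumr; congr (_ * _ * _).
  have -> : #|J| = #|s @^-1: J|.
    by rewrite on_card_preimset //; exists (s^-1)%g => x _; rewrite ?permK ?permKV.
  rewrite -sum1_card natr_sum big_mkcond /=; apply: eq_bigr => y _; rewrite inE.
  by case: (s y \in J).
apply: ler_sum => y _.
case: (boolP (s y \in J)) => syJ; last by rewrite !mulr0 !mul0r.
rewrite !mulr1.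
have [yI|yI] := boolP (y \in I); last first.
  suff -> : g (tperm a y * s)%g = g s by [].
  apply: eq_bigr => x xI; rewrite permM tpermD //.
    by apply: contraNneq aI => ->.
  by apply: contraNneq yI => ->.
rewrite /g (bigD1 y) //= [X in _ <= _ * X](bigD1 y) //= permM tpermR syJ.
have -> : \prod_(i in I | i != y) (1 + u * ((tperm a y * s)%g i \in J)%:R) =
    \prod_(i in I | i != y) (1 + u * (s i \in J)%:R).
  apply: eq_bigr => x /andP[xI xy]; rewrite permM tpermD //.
    by apply: contraNneq aI => ->.
  by rewrite eq_sym.
rewrite !mulrA; apply: ler_wpM2r.
  by apply: prodr_ge0 => x _; case: (s x \in J); rewrite ?mulr1 ?mulr0 ?addr0 //; lra.
(* The swap only replaces the factor 1 + u at [y] by the factor at [a]. If these differ, the gap is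
   u^2, nonnegative for either sign of u, so both tails are covered. *)
rewrite !mulrDr lerD2l; case: (s a \in J) => //=.
by rewrite mulr0 mulr0 mulr1 -expr2 sqr_ge0.
Qed.

(** The generating function of the number of hits is dominated by that of a binomial variable, so
    Chernoff's method works as for independent trials. *)
Lemma sum_prod_perm (R : realFieldType) (n : nat) (I J : {set 'I_n}) (u : R) :
  (0 < n)%N -> -1 <= u ->
  \sum_(s : 'S_n) \prod_(x in I) (1 + u * (s x \in J)%:R) <=
  (1 + u * (#|J|%:R / n%:R)) ^+ #|I| * n`!%:R.
Proof.
move=> n0 u1; elim: {I}#|I| {-2}I (erefl #|I|) => [|m IH] I Im.
  rewrite (cards0_eq Im) cards0 expr0 mul1r; under eq_bigr do rewrite big_set0.
  by rewrite sumr_const card_Sn.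
have [a aI] : exists a, a \in I by apply/card_gt0P; rewrite Im.
have Ia : #|I :\ a| = m by move: Im; rewrite (cardsD1 a) aI => -[].
have aN : a \notin I :\ a by rewrite !inE eqxx.
have N0 : 0 < n%:R :> R by rewrite ltr0n.
set p := #|J|%:R / n%:R.
have p1 : p <= 1.
  by rewrite ler_pdivrMr // mul1r ler_nat -[leqRHS]card_ord max_card.
have p0 : 0 <= p by rewrite divr_ge0.
have up : 0 <= 1 + u * p.
  by have := ler_wpM2r p0 u1; lra.
have step := sum_prod_perm_step J aN u1.
under eq_bigr => s _ do rewrite (big_setD1 a aI) /= mulrDl mul1r.
rewrite big_split /= Im exprS -mulrA.
apply: (@le_trans _ _ ((1 + u * p) * \sum_(s : 'S_n) \prod_(x in I :\ a) (1 + u * (s x \in J)%:R))).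
  rewrite mulrDl mul1r lerD2l -(ler_pM2l N0); apply: le_trans step _.
  by rewrite le_eqVlt; apply/orP; left; apply/eqP; rewrite /p; field; rewrite gt_eqF.
by rewrite ler_wpM2l // -Ia; apply: IH.
Qed.

Lemma expR_le_onePlus (R : realType) (u : R) : 0 <= u -> expR (u - u ^+ 2) <= 1 + u.
Proof.
move=> u0.
have w0 : 0 < 1 - (u - u ^+ 2) by have := sqr_ge0 (u - 1 / 2); lra.
rewrite -(ler_pM2r w0); apply: (@le_trans _ _ 1).
  rewrite -[X in _ <= X](expRxMexpNx_1 (u - u ^+ 2)); apply: ler_wpM2l; first exact: expR_ge0.
  exact: expR_ge1Dx.
have -> : (1 + u) * (1 - (u - u ^+ 2)) = 1 + u ^+ 3 by ring.
by rewrite lerDl exprn_ge0.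
Qed.

Lemma expR_le_oneMinus (R : realType) (u : R) :
  0 <= u <= 1 / 2 -> expR (- (u + 2 * u ^+ 2)) <= 1 - u.
Proof.
move=> /andP[u0 u12].
have u2 : 0 <= u ^+ 2 by exact: sqr_ge0.
have w0 : 0 < 1 + (u + 2 * u ^+ 2) by lra.
rewrite -(ler_pM2r w0); apply: (@le_trans _ _ 1).
  rewrite mulrC -[X in _ <= X](expRxMexpNx_1 (u + 2 * u ^+ 2)); apply: ler_wpM2r; first exact: expR_ge0.
  exact: expR_ge1Dx.
have -> : (1 - u) * (1 + (u + 2 * u ^+ 2)) = 1 + u ^+ 2 * (1 - 2 * u) by ring.
by rewrite lerDl mulr_ge0 //; lra.
Qed.

Lemma prod_hits (R : realType) (n : nat) (I J : {set 'I_n}) (s : 'S_n) (u : R) :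
  \prod_(x in I) (1 + u * (s x \in J)%:R) = (1 + u) ^+ #|[set x in I | s x \in J]|.
Proof.
rewrite -prodr_const [LHS]big_mkcond [RHS]big_mkcond /=; apply: eq_bigr => x _; rewrite inE.
by case: (x \in I); case: (s x \in J) => //=; rewrite ?mulr1 // mulr0 addr0.
Qed.

Lemma perm_hits_tail (R : realType) (n : nat) (I J : {set 'I_n}) (m dl : R) :
  (0 < n)%N -> 0 < m -> 0 <= dl <= m -> #|I|%:R * #|J|%:R / n%:R <= 4 * m ->
  #|[set s : 'S_n | dl < `|#|[set x in I | s x \in J]|%:R - #|I|%:R * #|J|%:R / n%:R| ]|%:R <=
    2 * expR (- (dl ^+ 2 / (32 * m))) * n`!%:R :> R.
Proof.
move=> n0 m0 /andP[dl0 dlm]; set mu := #|I|%:R * #|J|%:R / n%:R => mu4.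
have mu0 : 0 <= mu by rewrite divr_ge0 // mulr_ge0.
pose X (s : 'S_n) := #|[set x in I | s x \in J]|.
(* With this u the main term is 16 u^2 m, while the second-order losses are at most 5 u^2 m above
   the mean and 8 u^2 m below it; 8 u^2 m = dl^2 / (32 m) remains in both cases. *)
pose u : R := dl / (16 * m).
have um : dl = 16 * (u * m) by rewrite /u; field; rewrite gt_eqF.
have u0 : 0 <= u by rewrite divr_ge0 //; lra.
have u1 : u <= 1 / 2 by rewrite ler_pdivrMr; lra.
have expE : - (dl ^+ 2 / (32 * m)) = - (8 * u * (u * m)).
  by rewrite um; field; rewrite gt_eqF.
have n0R : n%:R != 0 :> R by rewrite pnatr_eq0 -lt0n.
have markov (v w t : R) (P : pred 'S_n) : -1 <= v ->
    (forall s, P s -> expR w <= (1 + v) ^+ X s) -> v * mu - w <= t ->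
    #|[set s | P s]|%:R <= expR t * n`!%:R :> R.
  move=> v1 Pw vt.
  have v1' : 0 <= 1 + v by lra.
  have H : expR w * #|[set s | P s]|%:R <= expR (v * mu) * n`!%:R.
    apply: (@le_trans _ _ (\sum_(s : 'S_n) \prod_(x in I) (1 + v * (s x \in J)%:R))).
      rewrite -sum1dep_card natr_sum mulr_sumr big_mkcond /=; apply: ler_sum => s _.
      rewrite prod_hits -/(X s); case: ifP => [/Pw|_]; rewrite ?mulr1 //.
      by rewrite exprn_ge0.
    apply: le_trans (sum_prod_perm _ _ n0 v1) _; rewrite ler_wpM2r //.
    have -> : v * mu = #|I|%:R * (v * (#|J|%:R / n%:R)) by rewrite /mu; field.
    rewrite expRM_natl lerXn2r ?nnegrE ?expR_ge0 ?expR_ge1Dx //.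
    have p1 : #|J|%:R / n%:R <= 1 :> R.
      by rewrite ler_pdivrMr ?ltr0n // mul1r ler_nat -[leqRHS]card_ord max_card.
    have p0 : 0 <= #|J|%:R / n%:R :> R by rewrite divr_ge0.
    by have := ler_wpM2r p0 v1; lra.
  rewrite -(ler_pM2l (expR_gt0 w)); apply: le_trans H _.
  rewrite [leRHS]mulrA -expRD ler_wpM2r // ler_expR; lra.
have up : #|[set s | mu + dl < (X s)%:R]|%:R <= expR (- (8 * u * (u * m))) * n`!%:R :> R.
  apply: (markov u ((mu + dl) * (u - u ^+ 2))); first lra.
    move=> s sX; have w0 : 0 <= u - u ^+ 2.
      by rewrite expr2 -{1}[u]mulr1 -mulrBr mulr_ge0 //; lra.
    apply: (@le_trans _ _ (expR (u - u ^+ 2) ^+ X s)).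
      by rewrite -expRM_natl ler_expR ler_wpM2r // ltW.
    by rewrite lerXn2r ?nnegrE ?expR_ge0 ?expR_le_onePlus //; lra.
  have : (mu + dl) * u ^+ 2 <= 5 * m * u ^+ 2 by rewrite ler_wpM2r ?sqr_ge0 //; lra.
  have : 0 <= u ^+ 2 * m by rewrite mulr_ge0 ?sqr_ge0 // ltW.
  have -> : u * mu - (mu + dl) * (u - u ^+ 2) = - (dl * u) + (mu + dl) * u ^+ 2 by ring.
  have -> : dl * u = 16 * (u ^+ 2 * m) by rewrite um; ring.
  have -> : 8 * u * (u * m) = 8 * (u ^+ 2 * m) by ring.
  lra.
have lo : #|[set s | (X s)%:R < mu - dl]|%:R <= expR (- (8 * u * (u * m))) * n`!%:R :> R.
  apply: (markov (- u) (- ((mu - dl) * (u + 2 * u ^+ 2)))); first lra.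
    move=> s sX; have w0 : 0 <= u + 2 * u ^+ 2 by rewrite addr_ge0 // mulr_ge0 // sqr_ge0.
    apply: (@le_trans _ _ (expR (- (u + 2 * u ^+ 2)) ^+ X s)).
      by rewrite -expRM_natl ler_expR mulrN lerN2 ler_wpM2r // ltW.
    by rewrite lerXn2r ?nnegrE ?expR_ge0 ?expR_le_oneMinus ?u0 //; lra.
  have : (mu - dl) * u ^+ 2 <= 4 * m * u ^+ 2 by rewrite ler_wpM2r ?sqr_ge0 //; lra.
  have -> : - u * mu - - ((mu - dl) * (u + 2 * u ^+ 2)) = - (dl * u) + 2 * ((mu - dl) * u ^+ 2) by ring.
  have -> : dl * u = 16 * (u ^+ 2 * m) by rewrite um; ring.
  have -> : 8 * u * (u * m) = 8 * (u ^+ 2 * m) by ring.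
  lra.
rewrite expE -mulrA mulrDl mul1r.
apply: le_trans (lerD up lo); rewrite -natrD ler_nat.
apply: leq_trans (leq_card_setU _ _); apply/subset_leq_card/fintype.subsetP => s.
rewrite !inE -/(X s) => H; apply/orP.
have [h|h] := leP 0 ((X s)%:R - mu); [left | right].
  by move: H; rewrite ger0_norm //; lra.
by move: H; rewrite ltr0_norm //; lra.
Qed.

Lemma card_ord_segment (n a b : nat) : (b <= n)%N -> #|[set x : 'I_n | (a <= x < b)%N]| = (b - a)%N.
Proof.
move=> bn; rewrite -(size_iota a (b - a)) cardE -(size_map val); apply: perm_size.
apply: uniq_perm; rewrite ?iota_uniq ?(map_inj_uniq val_inj) ?enum_uniq //.
move=> y; rewrite mem_iota; apply/mapP/idP => [[x]|yP].
  by rewrite mem_enum inE => xP -> /=; lia.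
have yn : (y < n)%N by lia.
by exists (Ordinal yn) => //; rewrite mem_enum inE /=; lia.
Qed.

Lemma card_unbalanced_rect (R : realType) (n L a b c d m : nat) : (0 < n)%N -> (0 < L)%N ->
  (a <= b <= n)%N -> (c <= d <= n)%N -> ((b - a) * (d - c) <= 4 * n * m)%N ->
  (256 * L <= m)%N ->
  #|[set s : 'S_n | 16 * Num.sqrt (m%:R * L%:R) <
     `|#|rect s a b c d|%:R - (b%:R - a%:R) * (d%:R - c%:R) / n%:R| :> R]|%:R <=
    2 * expR (- (8 * L%:R)) * n`!%:R :> R.
Proof.
move=> n0 L0 /andP[ab bn] /andP[cd dn] area Lm.
have m0 : 0 < m%:R :> R by rewrite ltr0n; lia.
have n0R : 0 < n%:R :> R by rewrite ltr0n.
pose I := [set x : 'I_n | (a <= x < b)%N]; pose J := [set x : 'I_n | (c <= x < d)%N].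
have LmR : 256 * L%:R <= m%:R :> R by rewrite -(natrM _ 256) ler_nat.
have sq : Num.sqrt (m%:R * L%:R) ^+ 2 = m%:R * L%:R :> R by rewrite sqr_sqrtr // mulr_ge0.
have sq0 : 0 <= Num.sqrt (m%:R * L%:R) :> R by exact: sqrtr_ge0.
have -> : 8 * L%:R = (16 * Num.sqrt (m%:R * L%:R)) ^+ 2 / (32 * m%:R) :> R.
  by rewrite exprMn sq; field; rewrite gt_eqF.
have dlm : 0 <= 16 * Num.sqrt (m%:R * L%:R : R) <= (m%:R : R).
  apply/andP; split; first by rewrite mulr_ge0.
  rewrite -ler_sqr ?nnegrE ?mulr_ge0 // exprMn sq.
  have -> : 16 ^+ 2 * (m%:R * L%:R) = m%:R * (256 * L%:R) :> R by ring.
  by rewrite expr2 ler_wpM2l.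
have areaR : #|I|%:R * #|J|%:R / n%:R <= 4 * m%:R :> R.
  rewrite ler_pdivrMr // !card_ord_segment // -!natrM ler_nat; clear -area; lia.
have := perm_hits_tail n0 m0 dlm areaR.
rewrite !card_ord_segment // !natrB //; apply: le_trans; rewrite ler_nat subset_leq_card //.
apply/fintype.subsetP => s; rewrite !inE.
by have -> : rect s a b c d = [set x in I | s x \in J] by apply/setP => x; rewrite !inE.
Qed.

(** There are (n+1)^5 <= 32 n^5 choices of four corners and a scale. Each fails with probability at
    most 2 exp (-8 L) <= 2 n^-8, because exp L >= 2^L > n. *)
Lemma card_unbalanced (R : realType) (n L : nat) : (0 < n)%N -> (0 < L)%N -> (n < 2 ^ L)%N ->
  #|[set s : 'S_n | ~~ `[< balanced R L s >]]|%:R <= 64 / n%:R ^+ 3 * n`!%:R :> R.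
Proof.
move=> n0 L0 nL.
pose T : finType := ('I_n.+1 * 'I_n.+1 * 'I_n.+1 * 'I_n.+1 * 'I_n.+1)%type.
pose P (t : T) := let: (a, b, c, d, m) := t in
  [&& (a <= b <= n)%N, (c <= d <= n)%N, ((b - a) * (d - c) <= 4 * n * m)%N & (256 * L <= m)%N].
pose F (t : T) := let: (a, b, c, d, m) := t in
  [set s : 'S_n | 16 * Num.sqrt (m%:R * L%:R) <
     `|#|rect s a b c d|%:R - (b%:R - a%:R) * (d%:R - c%:R) / n%:R| :> R].
have U : (#|[set s : 'S_n | ~~ `[< balanced R L s >]]| <= \sum_(t | P t) #|F t|)%N.
  apply: card_union_bound => s; rewrite inE => /asboolPn nb.
  apply: contrapT => H; apply: nb => a b c d m ab cd area /andP[Lm mn].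
  rewrite leNgt; apply/negP => viol; apply: H.
  have [an bn cn dn mn'] : [/\ a < n.+1, b < n.+1, c < n.+1, d < n.+1 & m < n.+1]%N.
    by clear -ab cd mn; split; lia.
  exists (Ordinal an, Ordinal bn, Ordinal cn, Ordinal dn, Ordinal mn') => /=.
    by rewrite ab cd area Lm.
  by rewrite inE.
have : (\sum_(t | P t) #|F t|)%:R <= \sum_(t : T) 2 * expR (- (8 * L%:R)) * n`!%:R :> R.
  rewrite natr_sum big_mkcond /=; apply: ler_sum => -[[[[a b] c] d] m] _.
  case: ifP => [/and4P[ab cd area Lm]|_].
    exact: card_unbalanced_rect.
  by rewrite !mulr_ge0 // expR_ge0.
move=> H; apply: (@le_trans _ _ (\sum_(t | P t) #|F t|)%:R); first by rewrite ler_nat.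
apply: le_trans H _; rewrite sumr_const !card_prod !card_ord -[leLHS]mulr_natl [leLHS]mulrA ler_wpM2r //.
have N1 : 1 <= n%:R :> R by rewrite ler1n.
have N0 : 0 < n%:R :> R by rewrite ltr0n.
have eL : expR (- (8 * L%:R)) <= n%:R ^- 8 :> R.
  rewrite expRN lef_pV2 ?posrE ?expR_gt0 ?exprn_gt0 //.
  rewrite expRM_natl lerXn2r ?nnegrE ?expR_ge0 //.
  apply: (@le_trans _ _ (2 ^+ L)); first by rewrite -natrX ler_nat ltnW.
  rewrite -[L%:R]mulr1 expRM_natl lerXn2r ?nnegrE ?expR_ge0 //.
  by apply: le_trans (expR_ge1Dx 1); lra.
have n1 : n.+1%:R <= 2 * n%:R :> R by rewrite -natr1; lra.
have n5 : n.+1%:R ^+ 5 <= 32 * n%:R ^+ 5 :> R.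
  have -> : 32 * n%:R ^+ 5 = (2 * n%:R) ^+ 5 :> R by ring.
  by rewrite lerXn2r ?nnegrE // mulr_ge0.
rewrite !natrM.
have -> : n.+1%:R * n.+1%:R * n.+1%:R * n.+1%:R * n.+1%:R = n.+1%:R ^+ 5 :> R by ring.
apply: (@le_trans _ _ (32 * n%:R ^+ 5 * (2 * n%:R ^- 8))).
  by apply: ler_pM; rewrite ?mulr_ge0 ?exprn_ge0 ?expR_ge0 // ler_wpM2l.
by rewrite le_eqVlt; apply/orP; left; apply/eqP; field; rewrite gt_eqF.
Qed.

(** * Probability of similarity *)

Lemma similar_of_balanced (R : realType) (n k L B D e M r : nat) (s : {ffun 'I_k.+1 -> 'S_n}) :
  (0 < n)%N -> (0 < L)%N -> (n <= 2 ^ L)%N -> 800 ^+ 2 * L%:R ^+ 3 <= B%:R :> R -> (B <= n)%N ->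
  (14 * (n * B) <= D ^ 2)%N -> (0 < e)%N -> (2 * D < M * e)%N -> (2 * r <= B)%N ->
  (forall j, balanced R L (s j)) ->
  (crowding D e M r s * 2 ^ (r * k) < B ^ (r * k))%N ->
  perms_similar ((M * M) ^ k * (2 * r)) s.
Proof.
move=> n0 L0 nL hB Bn hD e0 DM rB bal few.
have [N [lab [_ labE labB labnear]]] := cellular_of_balanced n0 L0 hB hD bal Bn nL.
have labT j c : [set x in [set: 'I_n] | lab j x == c] = [set x | lab j x == c].
  by apply/setP => x; rewrite !inE.
(* [f j] is one fixed matching of corresponding cells; the product [t j * f j] applies [t j] first
   and so shuffles within the cells of the reference permutation. *)
have /fin_all_exists[f fP] : forall j : 'I_k, exists f : 'S_n,
    forall x, lab (lift ord0 j) (f x) = lab ord0 x.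
  by move=> j; apply: relabeling_perm => c; have := labE ord0 (lift ord0 j) c; rewrite !labT.
have labB0 x : (B <= #|[set y | lab ord0 y == lab ord0 x]|)%N.
  by have := labB ord0 x (finset.in_setT x); rewrite labT.
have [t tG unc] := @exists_uncrowded_matching n k D e M r B (lab ord0) s f labB0 rB few.
apply: (@similar_of_uncrowded n k D e M r s (fun j => (t j * f j)%g) e0 DM).
  move=> j x; rewrite permM.
  have E : lab (lift ord0 j) (f j (t j x)) = lab ord0 x.
    by rewrite fP; move: (tG j); rewrite inE => /forallP/(_ x)/eqP.
  by case: (labnear _ _ _ _ (finset.in_setT _) (finset.in_setT _) E) => ? ? ? ?; split.
move=> v p X XW Xr H; apply: (unc v p X XW Xr) => j x xX.
by have := H j x xX; rewrite permM.
Qed.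

(** A single term of the exponential series is at most its sum, and exp 1 <= 4. It serves to bound
    'C(2 e, r) by (8 e / r)^r. *)
Lemma expn_self_le_fact (R : realType) (r : nat) : (r ^ r <= 4 ^ r * r`!)%N.
Proof.
case: r => [//|r]; rewrite -(ler_nat R) natrM !natrX.
have f0 : 0 < (r.+1)`!%:R :> R by rewrite ltr0n fact_gt0.
rewrite -ler_pdivrMr //.
have e4 : expR 1 <= 4 :> R.
  have h : 1 / 2 <= expR (- (1 / 2)) :> R by apply: le_trans (expR_ge1Dx _); lra.
  have h2 : 1 / 4 <= expR (- (1 / 2)) ^+ 2 :> R.
    have -> : 1 / 4 = (1 / 2) ^+ 2 :> R by field.
    by rewrite lerXn2r ?nnegrE ?expR_ge0 //; lra.
  have E : expR 1 * expR (- (1 / 2)) ^+ 2 = 1 :> R.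
    by rewrite -expRM_natl -expRD (_ : 1 + _ = 0) ?expR0 //; field.
  by have := ler_wpM2l (expR_ge0 1) h2; rewrite E; lra.
apply: (@le_trans _ _ (expR r.+1%:R)).
  by have := @expR_ge1Dxn R r.+1%:R r (ler0n _ _); lra.
by rewrite -[r.+1%:R]mulr1 expRM_natl lerXn2r ?nnegrE ?expR_ge0.
Qed.

Lemma leq_ffact_expn (n m : nat) : (n ^_ m <= n ^ m)%N.
Proof.
elim: m => // m IH; rewrite ffactnSr expnSr.
by apply: leq_mul => //; exact: leq_subr.
Qed.

(** Markov's inequality for [crowding]. The hypothesis on [e] is what makes the average smaller than
    the threshold by a factor 2 per point of [X], up to the number of classes and windows. *)
Lemma card_crowded (R : realType) (n k B D e M r : nat) : (0 < n)%N -> (0 < B)%N -> (0 < r)%N ->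
  (2 * r <= n)%N -> (16 * e * (4 * e ^ 2) ^ k <= r * (n * B) ^ k)%N ->
  (#|[set s : {ffun 'I_k.+1 -> 'S_n} | B ^ (r * k) <= crowding D e M r s * 2 ^ (r * k)]| * 2 ^ r <=
    (M * M) ^ k * (2 * n) * n`! ^ k.+1)%N.
Proof.
move=> n0 B0 r0 rn small.
set S := [set s | _].
have crS : (#|S| * B ^ (r * k) <= (\sum_(s : {ffun 'I_k.+1 -> 'S_n}) crowding D e M r s) * 2 ^ (r * k))%N.
  rewrite -sum_nat_const big_distrl /= big_mkcond /=; apply: leq_sum => s _.
  by rewrite inE; case: ifP.
have sumC := @sum_crowding n k D e M r rn.
set T := (\sum_s _)%N in crS sumC.
(* Per point: 8 e / r from the binomial coefficient, 2 for the gain 2^-r, and 4 e^2 for each of the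
   [k] other permutations, whose two factors 2 come from the two switchings. *)
have binC : ('C(2 * e, r) * (2 * e ^ 2) ^ (r * k) * 2 ^ (r * k) * 2 ^ r <= (n * B) ^ (r * k))%N.
  have rr0 : (0 < r ^ r)%N by rewrite expn_gt0 r0.
  rewrite -(leq_pmul2r rr0).
  have b1 : ('C(2 * e, r) * r ^ r <= (8 * e) ^ r)%N.
    apply: (@leq_trans ('C(2 * e, r) * (4 ^ r * r`!))).
      by rewrite leq_mul2l (expn_self_le_fact R) orbT.
    rewrite mulnCA bin_ffact.
    have -> : ((8 * e) ^ r = 4 ^ r * (2 * e) ^ r)%N by rewrite -expnMn mulnA.
    by rewrite leq_mul2l leq_ffact_expn orbT.
  have -> : ('C(2 * e, r) * (2 * e ^ 2) ^ (r * k) * 2 ^ (r * k) * 2 ^ r * r ^ r =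
      'C(2 * e, r) * r ^ r * (2 ^ r * ((4 * e ^ 2) ^ k) ^ r))%N.
    by rewrite -expnM (mulnC k r) (_ : 4 * e ^ 2 = 2 * (2 * e ^ 2))%N ?(expnMn 2 (2 * _)); ring.
  apply: leq_trans (leq_mul b1 (leqnn _)) _.
  rewrite -!expnMn (mulnC r k) expnM -expnMn (mulnC _ r).
  by rewrite leq_exp2r //; apply: leq_trans small; apply/eq_leq; ring.
have nB0 : (0 < (n * B) ^ (r * k))%N by rewrite expn_gt0 muln_gt0 n0 B0.
rewrite -(leq_pmul2r nB0) {1}expnMn.
have -> : (#|S| * 2 ^ r * (n ^ (r * k) * B ^ (r * k)) = #|S| * B ^ (r * k) * (2 ^ r * n ^ (r * k)))%N by ring.
apply: leq_trans (leq_mul crS (leqnn _)) _.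
have -> : (T * 2 ^ (r * k) * (2 ^ r * n ^ (r * k)) = T * n ^ (r * k) * (2 ^ (r * k) * 2 ^ r))%N by ring.
apply: leq_trans (leq_mul sumC (leqnn _)) _.
set a := ((M * M) ^ k)%N; set b := (2 * n)%N; set c := 'C(2 * e, r) in binC *.
set d := ((2 * e ^ 2) ^ _)%N in binC *; set f := (n`! ^ _)%N; set g := (2 ^ (r * k))%N in binC *.
set h := (2 ^ r)%N in binC *.
have -> : (a * b * c * d * f * (g * h) = a * b * f * (c * d * g * h))%N by ring.
by rewrite leq_mul2l binC orbT.
Qed.

Lemma card_ffun_coord (k : nat) (T : finType) (P : pred T) (j : 'I_k.+1) :
  #|[set s : {ffun 'I_k.+1 -> T} | P (s j)]| = (#|[set x | P x]| * #|T| ^ k)%N.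
Proof.
pose F i := mem (if i == j then [set x | P x] else [set: T]).
have -> : #|[set s : {ffun 'I_k.+1 -> T} | P (s j)]| = #|family F|.
  apply: eq_card => s; rewrite inE; apply/idP/familyP => [Ps i|/(_ j)].
    by rewrite /F; case: eqP => [->|_]; rewrite inE.
  by rewrite /F eqxx inE.
rewrite card_family foldrE big_image /= (bigD1 j) //= /F eqxx; congr (_ * _)%N.
transitivity (\prod_(i < k.+1 | i != j) #|T|)%N.
  by apply: eq_bigr => i /negPf ->; rewrite cardsT.
by rewrite prod_nat_const; congr (_ ^ _)%N; rewrite cardC1 card_ord.
Qed.

Lemma prob_iid_uniformE (R : realType) (T : finType) (k : nat) (E : ('I_k -> T) -> Prop) :
  prob_iid_uniform R E = #|[set s : {ffun 'I_k -> T} | `[< E s >]]|%:R / #|T|%:R ^+ k.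
Proof.
rewrite /prob_iid_uniform /uniform_mass.
under eq_bigr => s _ do rewrite prodr_const card_ord.
by rewrite sumr_const cardsE -exprVn mulr_natl.
Qed.

Lemma prob_similar_ge (R : realType) (n k L B D e M r : nat) (E : ('I_k.+1 -> 'S_n) -> Prop) :
  (0 < n)%N -> (0 < L)%N -> (n < 2 ^ L)%N -> 800 ^+ 2 * L%:R ^+ 3 <= B%:R :> R -> (B <= n)%N ->
  (14 * (n * B) <= D ^ 2)%N -> (0 < e)%N -> (2 * D < M * e)%N -> (2 * r <= B)%N -> (0 < r)%N ->
  (16 * e * (4 * e ^ 2) ^ k <= r * (n * B) ^ k)%N ->
  (forall s, perms_similar ((M * M) ^ k * (2 * r)) s -> E s) ->
  1 - (k.+1%:R * (64 / n%:R ^+ 3) + ((M * M) ^ k * (2 * n))%:R / 2 ^+ r) <= prob_iid_uniform R E.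
Proof.
move=> n0 L0 nL hB Bn hD e0 DM rB r0 small EP.
have B0 : (0 < B)%N by lia.
have rn : (2 * r <= n)%N by lia.
rewrite prob_iid_uniformE.
set G := [set s | _].
have f0 : 0 < n`!%:R :> R by rewrite ltr0n fact_gt0.
pose U j := [set s : {ffun 'I_k.+1 -> 'S_n} | ~~ `[< balanced R L (s j) >]].
pose S := [set s : {ffun 'I_k.+1 -> 'S_n} | (B ^ (r * k) <= crowding D e M r s * 2 ^ (r * k))%N].
have cS := @card_crowded R n k B D e M r n0 B0 r0 rn small.
have cU j : #|U j|%:R <= 64 / n%:R ^+ 3 * n`!%:R ^+ k.+1 :> R.
  rewrite /U (card_ffun_coord (fun t : 'S_n => ~~ `[< balanced R L t >])) card_Sn natrM natrX.
  rewrite (exprS n`!%:R) mulrA ler_wpM2r ?exprn_ge0 //.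
  exact: card_unbalanced.
have cover : (n`! ^ k.+1 <= #|G| + (\sum_j #|U j| + #|S|))%N.
  have -> : (n`! ^ k.+1 = #|[set: {ffun 'I_k.+1 -> 'S_n}]|)%N.
    by rewrite cardsT card_ffun card_Sn card_ord.
  rewrite cardsT -(cardsC G) leq_add2l.
  pose F (i : option 'I_k.+1) : {set {ffun 'I_k.+1 -> 'S_n}} := if i is Some j then U j else S.
  apply: (@leq_trans (\sum_(i : option 'I_k.+1) #|F i|)%N).
    apply: card_union_bound => s; rewrite !inE => /asboolPn nE.
    apply: contrapT => H; apply: nE; apply: EP.
    apply: (@similar_of_balanced R n k L B D e M r s) => //; first exact: ltnW.
      move=> j; apply: contrapT => nb; apply: H; exists (Some j) => //.
      by rewrite inE; apply/asboolPn.
    rewrite ltnNge; apply/negP => cr; apply: H; exists None => //.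
    by rewrite inE.
  rewrite (bigD1 None) //= addnC leq_add2r.
  rewrite (reindex_omap Some id) /=; last by case.
  by apply/eq_leq; apply: eq_bigl => j; rewrite eqxx.
have c2 : #|S|%:R <= ((M * M) ^ k * (2 * n))%:R / 2 ^+ r * n`!%:R ^+ k.+1 :> R.
  rewrite mulrAC ler_pdivlMr ?exprn_gt0 // -!natrX -!natrM ler_nat.
  exact: cS.
rewrite card_Sn ler_pdivlMr ?exprn_gt0 // mulrBl mul1r lerBlDr mulrDl.
apply: (@le_trans _ _ (#|G|%:R + ((\sum_j #|U j|)%:R + #|S|%:R))).
  by rewrite -natrX -!natrD ler_nat.
rewrite lerD2l; apply: lerD => //.
rewrite natr_sum; apply: (@le_trans _ _ (\sum_(j < k.+1) 64 / n%:R ^+ 3 * n`!%:R ^+ k.+1)).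
  by apply: ler_sum => j _.
by rewrite sumr_const card_ord -[leLHS]mulr_natl mulrA.
Qed.

(** * Choice of the parameters *)

Lemma nat_root (p X : nat) : (0 < p)%N -> (0 < X)%N ->
  exists e, [/\ 0 < e, e ^ p <= X & X < e.+1 ^ p]%N.
Proof.
move=> p0 X0; pose P e := (e ^ p <= X)%N.
have P1 : exists e, P e by exists 1%N; rewrite /P exp1n.
have bd e : P e -> (e <= X)%N.
  by case: e => // e; apply: leq_trans; rewrite -{1}[e.+1]expn1 leq_pexp2l.
case: (ex_maxnP P1 bd) => e Pe emax; exists e; split=> //.
  by apply: emax; rewrite /P exp1n.
by rewrite ltnNge; apply/negP => /emax; rewrite ltnn.
Qed.

Lemma expn4S_le (x : nat) : (6 <= x)%N -> (x.+1 ^ 4 <= 2 * x ^ 4)%N.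
Proof.
move=> x6; have sq : (5 * x.+1 ^ 2 <= 7 * x ^ 2)%N by nia.
have := leq_mul sq sq.
have -> : (5 * x.+1 ^ 2 * (5 * x.+1 ^ 2) = 25 * x.+1 ^ 4)%N by ring.
have -> : (7 * x ^ 2 * (7 * x ^ 2) = 49 * x ^ 4)%N by ring.
by move: (x.+1 ^ 4)%N (x ^ 4)%N => y z; lia.
Qed.

Lemma double_expn4_le (L : nat) : (32 <= L)%N -> (2 * L ^ 4 <= 2 ^ L)%N.
Proof.
elim: L => // L IH; rewrite leq_eqVlt => /predU1P[<-|].
  have E : 32%N = (2 ^ 5)%N by [].
  by rewrite E -expnM -expnS leq_exp2l.
rewrite ltnS => L32; rewrite (expnS 2 L) leq_mul2l /=.
by apply: leq_trans (expn4S_le _) (IH L32); apply: leq_trans L32.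
Qed.

(** The factor [4 * k + 4] in [r] makes 2^r at least n^(4k+4): n^(4k) pays for the displacement
    classes, n for the windows and n^3 for the failure probability. [8 * k + 8 <= L] gives
    [2 * r <= L * L <= B]. *)
Lemma parameters_exist (k n L : nat) (B := (L ^ 4)%N) (r := ((4 * k + 4) * L)%N) :
  (0 < k)%N -> (32 <= L)%N -> (8 * k + 8 <= L)%N -> (2 ^ L <= 2 * n)%N -> (n < 2 ^ L)%N ->
  exists D e M,
   [/\ [/\ B <= n, 14 * (n * B) <= D ^ 2, 0 < e & 2 * D < M * e],
       [/\ 2 * r <= B, 0 < r, 16 * e * (4 * e ^ 2) ^ k <= r * (n * B) ^ k &
         (M * M) ^ k * (2 * n) * n ^ 3 <= 2 * 9 ^ k * 2 ^ r],
       (M * M) ^ k * (2 * r) <= 576 ^ k * (32 * (4 ^ k * 2 ^ (2 * k + 1))) * e &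
       e ^ (2 * k + 1) <= r * (n * B) ^ k]%N.
Proof.
move=> k0 L32 kL Ln nL.
have Bn : (B <= n)%N.
  by have := leq_trans (double_expn4_le L32) Ln; rewrite leq_mul2l.
have LL : (L * L <= B)%N.
  by rewrite /B (_ : L ^ 4 = L * L * (L * L))%N ?leq_pmulr //; [nia | ring].
have rB : (2 * r <= B)%N.
  apply: leq_trans LL; rewrite /r mulnA leq_mul2r; apply/orP; right; lia.
have r16 : (16 <= r)%N by rewrite /r; nia.
have n32 : (32 <= n)%N by clear -Bn LL L32; nia.
have B1 : (0 < B)%N by clear -LL L32; nia.
have [D0 [D00 D01 D02]] := @nat_root 2 (n * B) isT ltac:(clear -n32 B1; nia).
have nBD : (n * B < 4 * D0 ^ 2)%N by clear -D00 D02; nia.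
(* [16 * e * (4 * e ^ 2) ^ k] equals [e ^ q * c], so [e] is the integer q-th root of the quotient by
   [c], the largest box side that [card_crowded] admits. *)
pose q := (2 * k + 1)%N; pose c := (16 * 4 ^ k)%N.
have c0 : (0 < c)%N by rewrite muln_gt0 expn_gt0.
have X0 : (0 < r * (n * B) ^ k %/ c)%N.
  rewrite divn_gt0 //; apply: leq_mul => //; rewrite leq_exp2r //; clear -n32 B1; nia.
have [e [e0 e1 e2]] := @nat_root q _ ltac:(by rewrite /q addn1) X0.
have small : (16 * e * (4 * e ^ 2) ^ k <= r * (n * B) ^ k)%N.
  apply: leq_trans (leq_trunc_div (r * (n * B) ^ k) c).
  have -> : (16 * e * (4 * e ^ 2) ^ k = e ^ q * c)%N.
    by rewrite expnMn -expnM /q expnD expn1 /c; ring.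
  by rewrite leq_mul2r e1 orbT.
have large : (r * (n * B) ^ k <= c * (2 ^ q * e ^ q))%N.
  apply: ltnW; apply: (leq_trans (ltn_ceil (r * (n * B) ^ k) c0)).
  rewrite mulnC leq_mul2l; apply/orP; right.
  apply: leq_trans e2 _; rewrite -expnMn leq_exp2r ?/q ?addn1 //; clear -e0; lia.
(* Rounding the root loses at most a factor 2, so D^2 = 64 D0^2 exceeds 16 n B, enough for the
   required 14 n B. *)
pose D := (8 * D0)%N.
have DE : (D ^ 2 = 64 * D0 ^ 2)%N by rewrite /D expnMn.
have eq_le : (e ^ q <= r * (n * B) ^ k)%N.
  by apply: leq_trans e1 (leq_trans (leq_div _ _) _).
(* If [e] exceeded [D], then e^(2k) >= (D^2)^k >= (n B)^k would leave e <= r, so n B <= D^2 < r^2;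
   but [2 * r <= B <= n] gives n B >= 4 r^2. *)
have eD : (e <= D)%N.
  rewrite leqNgt; apply/negP => De.
  have nBDD : (n * B <= D ^ 2)%N by rewrite DE; clear -nBD; lia.
  have er : (e <= r)%N.
    have Dk : (0 < (D ^ 2) ^ k)%N by rewrite expn_gt0 expn_gt0 /D muln_gt0 D00.
    rewrite -(leq_pmul2r Dk).
    apply: (@leq_trans (e ^ q)).
      by rewrite /q addn1 (expnS e) leq_mul2l -expnM leq_exp2r ?muln_gt0 // (ltnW De) orbT.
    by apply: leq_trans eq_le _; rewrite leq_mul2l leq_exp2r // nBDD orbT.
  clear -De er rB Bn nBDD r16; nia.
pose M := (2 * D %/ e).+1.
have DM : (2 * D < M * e)%N by exact: ltn_ceil.
have Me : (M * e <= 3 * D)%N.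
  rewrite /M mulSn; have := leq_trunc_div (2 * D) e; clear -eD; lia.
exists D, e, M; split=> //.
- split=> //; rewrite DE; clear -nBD; lia.
- split=> //; first exact: leq_trans r16.
  have Dn : (D <= n ^ 2)%N.
    rewrite -(@leq_exp2r _ _ 2) // DE.
    have : (D0 ^ 2 <= n * n)%N by apply: leq_trans D01 _; rewrite leq_mul2l Bn orbT.
    have : (64 <= n * n)%N by clear -n32; nia.
    have -> : ((n ^ 2) ^ 2 = n * n * (n * n))%N by ring.
    set x := (n * n)%N; clear; nia.
  have Mn : (M <= 3 * n ^ 2)%N.
    apply: (@leq_trans (2 * D).+1); first by rewrite /M ltnS leq_div.
    have : (0 < n ^ 2)%N by rewrite expn_gt0; clear -n32; lia.
    by clear -Dn; lia.
  have -> : (2 * 9 ^ k * 2 ^ r = 9 ^ k * (2 ^ L) ^ (4 * k + 4) * 2)%N.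
    by rewrite /r (mulnC _ L) expnM; ring.
  apply: (@leq_trans (9 ^ k * n ^ (4 * k + 4) * 2)).
    have -> : (9 ^ k * n ^ (4 * k + 4) * 2 = (3 * n ^ 2 * (3 * n ^ 2)) ^ k * (2 * n) * n ^ 3)%N.
      rewrite (_ : 3 * n ^ 2 * (3 * n ^ 2) = 9 * n ^ 4)%N; last by ring.
      by rewrite expnMn -expnM expnD; ring.
    by rewrite !leq_mul2r leq_exp2r // leq_mul ?orbT.
  by rewrite leq_mul2r leq_mul2l leq_exp2r ?(ltnW nL) ?orbT // addnS.
(* After multiplication by e^(2k), the bound M e <= 3 D yields 9 * 64 = 576 per factor n B, and the
   maximality of [e] bounds r (n B)^k by a constant times e^q. *)
- have ek : (0 < e ^ (2 * k))%N by rewrite expn_gt0 e0.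
  rewrite -(leq_pmul2r ek).
  have -> : ((M * M) ^ k * (2 * r) * e ^ (2 * k) = (M * e * (M * e)) ^ k * (2 * r))%N.
    by rewrite (_ : M * e * (M * e) = (M * M) * e ^ 2)%N ?(expnMn (M * M)) -?expnM; ring.
  have : ((M * e * (M * e)) ^ k <= (576 * (n * B)) ^ k)%N.
    rewrite leq_exp2r //; apply: leq_trans (leq_mul Me Me) _.
    rewrite (_ : 3 * D * (3 * D) = 9 * D ^ 2)%N; last by ring.
    rewrite DE; clear -D01; lia.
  move=> H; apply: leq_trans (leq_mul H (leqnn _)) _.
  rewrite expnMn.
  have -> : (576 ^ k * (n * B) ^ k * (2 * r) = 576 ^ k * 2 * (r * (n * B) ^ k))%N by ring.
  apply: leq_trans (leq_mul (leqnn _) large) _.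
  apply/eq_leq; rewrite /c /q (expnD e) expn1; ring.
Qed.

Lemma le_ln_of_expn2_le (R : realType) (n L : nat) : (32 <= L)%N -> (2 ^ L <= 2 * n)%N ->
  1 <= ln n%:R :> R /\ L%:R <= 4 * ln n%:R :> R.
Proof.
move=> L32 Ln.
have n0 : 0 < n%:R :> R.
  by rewrite ltr0n lt0n; apply: contraTneq Ln => ->; rewrite muln0 leqn0 expn_eq0.
have L32R : 32 <= L%:R :> R by rewrite (ler_nat _ 32).
have h : expR (1 / 2) <= 2 :> R.
  have h : 1 / 2 <= expR (- (1 / 2)) :> R by apply: le_trans (expR_ge1Dx _); lra.
  by have := ler_wpM2l (expR_ge0 (1 / 2)) h; rewrite expRxMexpNx_1; lra.
have : L%:R / 2 - 1 <= ln n%:R :> R.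
  rewrite -[leLHS]expRK ler_ln ?posrE ?expR_gt0 // expRB ler_pdivrMr ?expR_gt0 //.
  apply: (@le_trans _ _ (2 ^+ L)).
    rewrite -[L%:R / 2]mulr1 -mulrA (mulrC _ 1) mulrA mulr1 -[_^-1]mul1r expRM_natl.
    by rewrite lerXn2r ?nnegrE ?expR_ge0.
  apply: (@le_trans _ _ (2 * n%:R)); first by rewrite -natrX -natrM ler_nat.
  rewrite mulrC ler_wpM2l ?(ltW n0) //; apply: le_trans (expR_ge1Dx 1); lra.
by move=> H; split; lra.
Qed.

Lemma powR_root_le (R : realType) (x y : R) (q : nat) : (0 < q)%N -> 0 <= x ->
  x ^+ q <= y -> x <= y `^ q%:R^-1.
Proof.
move=> q0 x0 xy.
have -> : x = (x ^+ q) `^ q%:R^-1.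
  by rewrite -powR_mulrn // -powRrM divff ?powRr1 // pnatr_eq0 -lt0n.
by apply: ge0_ler_powR => //; rewrite nnegrE ?exprn_ge0 // (le_trans _ xy) ?exprn_ge0.
Qed.

(** The power L^(4k+1) comes from one L in [r] and 4k in B^k. Its q-th root fits the stated exponent
    because 4k/(2k+1) <= 3k/2 for k >= 1; raising the exponent is allowed since ln n >= 1. *)
Lemma box_side_le (R : realType) (k n L e : nat) : (0 < k)%N -> (32 <= L)%N ->
  (2 ^ L <= 2 * n)%N -> (e ^ (2 * k + 1) <= (4 * k + 4) * L * (n * L ^ 4) ^ k)%N ->
  e%:R <= ((4 * k + 4)%:R * 4 ^+ (4 * k + 1)) `^ (2 * k + 1)%:R^-1 *
    n%:R `^ (k%:R / (2 * k + 1)%:R) * ln n%:R `^ (3 * k%:R / 2 + 1 / (2 * k + 1)%:R) :> R.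
Proof.
move=> k0 L32 Ln eq_le.
have [l1 Ll] := @le_ln_of_expn2_le R n L L32 Ln.
set q := (2 * k + 1)%N in eq_le *; set lam := ln n%:R in l1 Ll *.
have l0 : 0 <= lam by lra.
have q0 : (0 < q)%N by rewrite /q addn1.
have qR : 0 < q%:R :> R by rewrite ltr0n.
apply: le_trans (_ : _ <= (((4 * k + 4)%:R * 4 ^+ (4 * k + 1)) * n%:R ^+ k * lam ^+ (4 * k + 1)) `^ q%:R^-1) _.
  apply: powR_root_le => //.
  apply: (@le_trans _ _ ((4 * k + 4) * L * (n * L ^ 4) ^ k)%:R); first by rewrite -natrX ler_nat.
  have -> : ((4 * k + 4) * L * (n * L ^ 4) ^ k = (4 * k + 4) * n ^ k * L ^ (4 * k + 1))%N.
    by rewrite expnMn -expnM expnD expn1; ring.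
  rewrite !natrM !natrX.
  have -> : (4 * k + 4)%:R * 4 ^+ (4 * k + 1) * n%:R ^+ k * lam ^+ (4 * k + 1) =
      (4 * k + 4)%:R * n%:R ^+ k * (4 * lam) ^+ (4 * k + 1) :> R by rewrite exprMn; ring.
  rewrite ler_wpM2l ?mulr_ge0 ?exprn_ge0 // lerXn2r ?nnegrE //; lra.
rewrite !powRM ?mulr_ge0 ?exprn_ge0 //.
rewrite -[n%:R ^+ k]powR_mulrn // -[lam ^+ _]powR_mulrn // -!powRrM.
rewrite ler_wpM2l ?mulr_ge0 ?powR_ge0 // ler_powR //.
rewrite natrD natrM mulrDl lerD2r ler_pdivrMr //.
have k1 : 1 <= k%:R :> R by rewrite ler1n.
have -> : q%:R = 2 * k%:R + 1 :> R by rewrite /q natrD natrM.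
have : k%:R * 1 <= k%:R * k%:R :> R by rewrite ler_wpM2l.
lra.
Qed.

Lemma cvg_natrM_cube_inv (R : realType) (c : R) : 0 <= c ->
  ((fun n : nat => n%:R * (c / n%:R ^+ 3)) @ \oo --> (0 : R))%classic.
Proof.
move=> c0.
apply: (@squeeze_cvgr _ _ _ _ (fun=> 0) (fun n => 2 * c * harmonic n)).
- near=> n; apply/andP; split; first by rewrite !mulr_ge0 ?invr_ge0 ?exprn_ge0.
  have n0 : 0 < n%:R :> R by rewrite ltr0n; near: n; exists 1%N.
  have n1 : 1 <= n%:R :> R by rewrite ler1n -(ltr0n R).
  rewrite /harmonic /=.
  have -> : n%:R * (c / n%:R ^+ 3) = c * (n%:R ^+ 2)^-1 by field; rewrite gt_eqF.
  rewrite -mulrA mulrCA ler_wpM2l //.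
  rewrite ler_pdivlMr // mulrC ler_pdivrMr ?exprn_gt0 //.
  by rewrite -natr1; have := ler_wpM2r (ltW n0) n1; rewrite expr2; lra.
- exact: cvg_cst.
- have := cvgM (cvg_cst (2 * c)) (@cvg_harmonic R); rewrite mulr0; exact.
Unshelve. all: by end_near. Qed.

Theorem theorem1p4 (R : realType) (k : nat) (hk : (2 <= k)%N) :
  exists C : R, 0 < C /\
  exists eps : nat -> R,
    ((fun n : nat => n%:R * eps n) @ \oo --> (0 : R))%classic /\
    forall n : nat, (2 <= n)%N ->
      1 - eps n <=
      prob_iid_uniform R (fun sigma : 'I_k -> 'S_n =>
        exists l : nat,
          l%:R <= C * (n%:R `^ ((k%:R - 1) / (2 * k%:R - 1)))
                    * (ln n%:R `^ (3 * (k%:R - 1) / 2 + 1 / (2 * k%:R - 1)))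
          /\ perms_similar l sigma).
Proof.
case: k hk => // k; rewrite ltnS => k0.
have kE : k.+1%:R - 1 = k%:R :> R by rewrite -natr1 addrK.
have qE : 2 * k.+1%:R - 1 = (2 * k + 1)%:R :> R by rewrite -natr1 natrD natrM; ring.
rewrite kE qE.
pose c2 : R := (576 ^ k * (32 * (4 ^ k * 2 ^ (2 * k + 1))))%:R.
pose c3 : R := ((4 * k + 4)%:R * 4 ^+ (4 * k + 1)) `^ (2 * k + 1)%:R^-1.
have c20 : 0 < c2 by rewrite ltr0n !muln_gt0 !expn_gt0.
have c30 : 0 < c3 by rewrite powR_gt0 // mulr_gt0 ?exprn_gt0 // ltr0n addnS.
exists (c2 * c3); split; first exact: mulr_gt0.
have [K0 K0P] : exists K0 : nat, 800 ^+ 2 <= K0%:R :> R.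
  exists (Num.truncn (800 ^+ 2 : R)).+1; apply: ltW; exact: truncnS_gt.
(* For n >= 2^K all size conditions on [L] hold; in particular L >= 800^2, so that L^4 dominates
   800^2 L^3. *)
pose K := (K0 + 32 + (8 * k + 8))%N.
(* The last summand makes c / n^3 at least 1 for n < 2^K, where the bound is then trivial; the
   others are the discrepancy and crowding errors. The error n^-3 is more than o(1/n) demands. *)
pose c : R := k.+1%:R * 64 + (2 * 9 ^ k)%:R + (2 ^ K)%:R ^+ 3.
have c0 : 0 <= c by rewrite !addr_ge0 ?mulr_ge0 ?exprn_ge0.
exists (fun n => c / n%:R ^+ 3); split; first exact: cvg_natrM_cube_inv.
move=> n n2; have n0 : (0 < n)%N by apply: leq_trans n2.
have nR : 0 < n%:R ^+ 3 :> R by rewrite exprn_gt0 // ltr0n.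
have [nK|Kn] := ltnP n (2 ^ K)%N.
  apply: (@le_trans _ _ 0); last by rewrite prob_iid_uniformE divr_ge0 // exprn_ge0.
  rewrite subr_le0 ler_pdivlMr // mul1r.
  have : n%:R ^+ 3 <= (2 ^ K)%:R ^+ 3 :> R by rewrite lerXn2r ?nnegrE // ler_nat ltnW.
  by move=> H; apply: le_trans H _; rewrite /c lerDr addr_ge0 // mulr_ge0.
pose L := (trunc_log 2 n).+1.
have nL : (n < 2 ^ L)%N by apply: trunc_log_ltn.
have Ln : (2 ^ L <= 2 * n)%N by rewrite expnS leq_mul2l /= trunc_logP.
have KL : (K <= L)%N.
  by rewrite ltnW // -(ltn_exp2l _ _ (isT : (1 < 2)%N)) (leq_ltn_trans Kn nL).
have L32 : (32 <= L)%N by rewrite (leq_trans _ KL) // /K; clear; lia.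
have kL : (8 * k + 8 <= L)%N by rewrite (leq_trans _ KL) // /K; clear; lia.
have K0L : (K0 <= L)%N by rewrite (leq_trans _ KL) // /K; clear; lia.
have [D [e [M [[h1 h2 h3 h4] [h5 h6 h7 h8] h9 h10]]]] := @parameters_exist k n L k0 L32 kL Ln nL.
have hB : 800 ^+ 2 * L%:R ^+ 3 <= (L ^ 4)%:R :> R.
  by rewrite natrX (exprS _ 3) ler_wpM2r ?exprn_ge0 // (le_trans K0P) // ler_nat.
apply: le_trans (@prob_similar_ge R n k L (L ^ 4) D e M _ _ n0 isT nL hB h1 h2 h3 h4 h5 h6 h7 _).
  rewrite lerD2l lerN2.
  apply: (@le_trans _ _ (k.+1%:R * (64 / n%:R ^+ 3) + (2 * 9 ^ k)%:R / n%:R ^+ 3)).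
    rewrite lerD2l ler_pdivrMr ?exprn_gt0 // mulrAC ler_pdivlMr //.
    by rewrite -!natrX -!natrM ler_nat.
  rewrite mulrA -mulrDl ler_wpM2r ?invr_ge0 ?(ltW nR) //.
  by rewrite /c lerDl exprn_ge0.
move=> s sim; exists ((M * M) ^ k * (2 * ((4 * k + 4) * L)))%N; split => //.
apply: (@le_trans _ _ (c2 * e%:R)); first by rewrite -natrM ler_nat.
rewrite -!mulrA ler_pM2l // !mulrA.
exact: box_side_le h10.
Qed.
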